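(* Every spherical 2-orbifold of revolution has infinitely many closed geodesics.
   Context: **Spherical surface of revolution.** Let $\alpha=(g,h):[u_N,u_S]\to\mathbb{R}^2$ be a simple (no self-intersections) regular $C^\infty$ plane curve with $h\ge 0$ and $h(u)=0$ if and only if $u=u_N$ or $u=u_S$ (the profile curve). The spherical surface of revolution $M\subset\mathbb{R}^3$ with profile curve $\alpha$ is the surface parametrized by $\mathbf{x}(u,v)=(g(u),h(u)\cos v,h(u)\sin v)$, $(u,v)\in[u_N,u_S]\times\mathbb{R}$, with the induced metric. It is homeomorphic to $S^2$. Its poles are the points $N=\mathbf{x}(u_N,\cdot)$ and $S=\mathbf{x}(u_S,\cdot)$. Metric singularities may occur only at $N$ and $S$; away from the poles $M$ is a smooth Riemannian surface with metric $ds^2=E\,du^2+h(u)^2\,dv^2$, $E=g'(u)^2+h'(u)^2$. The function $g$ need not be monotone. **Orbifold of revolution.** Let $\phi_N,\phi_S$ be the angles between the profile curve and the axis of rotation (the $x$-axis) at the poles, so that $\sin\phi_N=\dfrac{h'(u_N)}{\sqrt{g'(u_N)^2+h'(u_N)^2}}$ and $\sin\phi_S=\dfrac{-h'(u_S)}{\sqrt{g'(u_S)^2+h'(u_S)^2}}$. $M$ is a spherical 2-orbifold of revolution if the tangent cone at each pole is isometric to a quotient of the flat plane $\mathbb{R}^2$ by a finite cyclic group of rotations fixing the origin; equivalently, $\sin\phi_N=1/m$ and $\sin\phi_S=1/k$ for some positive integers $m,k$. **Geodesics.** Geodesics have unit speed. A meridian is a geodesic $v\equiv$ const joining $N$ to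 $S$. A non-meridional geodesic never meets a pole and is taken to be defined on all of $\mathbb{R}$. A geodesic $\gamma$ is closed if there are $t_0\ne t_1$ with $\gamma(t_0)=\gamma(t_1)$ and $\gamma'(t_0)=\gamma'(t_1)$. With these conventions meridians are not closed geodesics. Closed geodesics are counted geometrically, i.e. two are the same if they have the same image. *)

(* Defs.v *)
(* Stdlib reals and Coquelicot. *)
From Stdlib Require Import Reals.
From Coquelicot Require Import Coquelicot.
Open Scope R_scope.

Definition R3 : Type := (R * R * R)%type.

Definition px (p : R3) : R := fst (fst p).
Definition py (p : R3) : R := snd (fst p).
Definition pz (p : R3) : R := snd p.

Definition dot (p q : R3) : R := px p * px q + py p * py q + pz p * pz q.

Definition Derive3 (c : R -> R3) (t : R) : R3 :=
  (Derive (fun s => px (c s)) t,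
   Derive (fun s => py (c s)) t,
   Derive (fun s => pz (c s)) t).

Definition ex_derive3 (c : R -> R3) (t : R) : Prop :=
  ex_derive (fun s => px (c s)) t /\
  ex_derive (fun s => py (c s)) t /\
  ex_derive (fun s => pz (c s)) t.

(* C^oo on the closed interval [a, b], in the usual sense of smoothness on an
   open interval containing it; the values of f off [a, b] play no other role,
   and the two-sided derivatives at a and b are the one-sided ones. *)
Definition smooth_on (a b : R) (f : R -> R) : Prop :=
  exists eps : R, 0 < eps /\
    forall (n : nat) (u : R), a - eps < u < b + eps -> ex_derive_n f n u.

Record profile_curve (g h : R -> R) (uN uS : R) : Prop := {
  profile_interval : uN < uS;
  profile_smooth_g : smooth_on uN uS g;
  profile_smooth_h : smooth_on uN uS h;
  profile_regular : forall u : R, uN <= u <= uS ->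
    ~ (Derive g u = 0 /\ Derive h u = 0);
  profile_simple : forall u1 u2 : R, uN <= u1 <= uS -> uN <= u2 <= uS ->
    g u1 = g u2 -> h u1 = h u2 -> u1 = u2;
  profile_nonneg : forall u : R, uN <= u <= uS -> 0 <= h u;
  profile_zero : forall u : R, uN <= u <= uS ->
    (h u = 0 <-> u = uN \/ u = uS)
}.

Definition revolution (g h : R -> R) (u v : R) : R3 :=
  (g u, h u * cos v, h u * sin v).

Definition sin_phi_N (g h : R -> R) (uN : R) : R :=
  Derive h uN / sqrt (Derive g uN ^ 2 + Derive h uN ^ 2).

Definition sin_phi_S (g h : R -> R) (uS : R) : R :=
  - Derive h uS / sqrt (Derive g uS ^ 2 + Derive h uS ^ 2).

(* The tangent cone at a pole is a right circular cone whose generators make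
   the angle phi with the axis, i.e. a flat cone of total angle 2 PI sin phi,
   while the quotient of the plane by rotations of order m has total angle
   2 PI / m. *)
Definition orbifold_of_revolution (g h : R -> R) (uN uS : R) : Prop :=
  profile_curve g h uN uS /\
  exists m k : nat, (0 < m)%nat /\ (0 < k)%nat /\
    sin_phi_N g h uN = 1 / INR m /\ sin_phi_S g h uS = 1 / INR k.

(* Complete unit-speed geodesics of the surface with its poles removed.  The
   metric is the one induced from R^3, so the covariant derivative of c' is the
   tangential part of c''; the last clause says that it vanishes.  Two
   derivatives suffice, since solutions of the geodesic equation are smooth.
   A meridian has finite length and ends at the poles, so it is not the image of
   such a curve: these are exactly the non-meridional geodesics. *)
Definition geodesic (g h : R -> R) (uN uS : R) (c : R -> R3) : Prop :=
  (forall t : R, ex_derive3 c t) /\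
  (forall t : R, ex_derive3 (Derive3 c) t) /\
  (forall t : R, dot (Derive3 c t) (Derive3 c t) = 1) /\
  (forall t : R, exists u v : R,
     uN < u < uS /\
     c t = revolution g h u v /\
     dot (Derive3 (Derive3 c) t) (Derive3 (fun s => revolution g h s v) u) = 0 /\
     dot (Derive3 (Derive3 c) t) (Derive3 (fun s => revolution g h u s) v) = 0).

Definition closed_geodesic (g h : R -> R) (uN uS : R) (c : R -> R3) : Prop :=
  geodesic g h uN uS c /\
  exists t0 t1 : R, t0 <> t1 /\ c t0 = c t1 /\ Derive3 c t0 = Derive3 c t1.

Definition same_image (c1 c2 : R -> R3) : Prop :=
  forall p : R3, (exists t : R, c1 t = p) <-> (exists t : R, c2 t = p).

Definition infinitely_many_closed_geodesics (g h : R -> R) (uN uS : R) : Prop :=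
  exists C : nat -> R -> R3,
    (forall n : nat, closed_geodesic g h uN uS (C n)) /\
    (forall i j : nat, i <> j -> ~ same_image (C i) (C j)).

(* Main.v *)
(* By Clairaut's relation h^2 v' = c is constant along a geodesic.  For small
   c > 0 the level set h = c in the profile consists of two points a < b, one
   near each pole, and the geodesic with constant c oscillates between the
   parallels a and b, turning by D(c) = int_a^b c sqrt(E) / (h sqrt(h^2 - c^2)) du
   on each passage.  It is closed when D(c) is a rational multiple of PI.  D is
   continuous, and D(c) -> (m + k) PI / 2 as c -> 0, because sqrt(E) / |h'| is m
   and k at the poles.  So either D is constant, equal to this rational multiple
   of PI, and all these geodesics are closed, or D takes infinitely many rational
   multiples of PI as values.  Geodesics with different c have different images,
   since c is the distance from the image to the axis. *)

Require Import Defs.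
From Stdlib Require Import Reals Lra Lia ClassicalEpsilon.
From Coquelicot Require Import Coquelicot.
Open Scope R_scope.

(** * One-variable calculus *)

(** Taken literally, D(c) is an improper integral whose singular ends a and b move with c, and h
    cannot serve as the variable because it need not be monotone between the poles. For fixed c the
    remedy is an angular variable s in which one passage from a to b is s in [0, PI]. There the
    singularities cancel, and the geodesic is written down for all times by quadratures and one
    inverse function, without an existence theorem for differential equations. For varying c the
    integral has to live on an interval independent of c. The term c h' / (h sqrt (h^2 - c^2)) is
    the derivative of arccos (c / h), which stays between 0 and PI / 2 and tends to PI / 2 wherever
    h > 0. Integration by parts leaves only this bounded function, next to a term supported where h
    exceeds a level y > c. The weight w it carries is sqrt E / h' at the poles, that is m at N and -
    k at S, so the limit of D is - PI / 2 times the integral of w', namely (m + k) PI / 2. *)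

Definition slope (f : R -> R) (l x y : R) : R :=
  if Req_EM_T y x then l else (f y - f x) / (y - x).

Lemma slope_eq (f : R -> R) (l x y : R) : f y - f x = (y - x) * slope f l x y.
Proof.
unfold slope; destruct (Req_EM_T y x) as [->|n]; [ring | field; lra].
Qed.

Lemma slope_at (f : R -> R) (l x : R) : slope f l x x = l.
Proof. unfold slope; destruct (Req_EM_T x x); [reflexivity | lra]. Qed.

Lemma slope_ne (f : R -> R) (l x y : R) :
  y <> x -> slope f l x y = (f y - f x) / (y - x).
Proof. intros n; unfold slope; destruct (Req_EM_T y x); [lra | reflexivity]. Qed.

Lemma continuous_eps (f : R -> R) (x : R) :
  (forall eps, 0 < eps -> exists d, 0 < d /\
     forall y, Rabs (y - x) < d -> Rabs (f y - f x) < eps) <-> continuous f x.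
Proof.
split.
- intros H; apply continuity_pt_filterlim; intros eps Heps.
  destruct (H eps Heps) as [d [Hd H1]]; exists d; split; [exact Hd|].
  intros y [_ Hy]; apply H1, Hy.
- intros H eps Heps; apply continuity_pt_filterlim in H.
  destruct (H eps Heps) as [d [Hd H1]]; exists d; split; [exact Hd|].
  intros y Hy; destruct (Req_dec y x) as [->|n].
  + replace (f x - f x) with 0 by ring; rewrite Rabs_R0; exact Heps.
  + apply H1; split; [split; [exact I | auto] | exact Hy].
Qed.

Lemma slope_continuous (f : R -> R) (l x : R) :
  is_derive f x l -> continuous (slope f l x) x.
Proof.
intros H; apply continuous_eps; intros eps Heps.
apply is_derive_Reals in H; destruct (H eps Heps) as [d Hd].
exists d; split; [apply cond_pos|]; intros y Hy; rewrite slope_at.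
destruct (Req_dec y x) as [->|n].
- rewrite slope_at; replace (l - l) with 0 by ring; rewrite Rabs_R0; exact Heps.
- rewrite slope_ne by exact n.
  specialize (Hd (y - x)); replace (x + (y - x)) with y in Hd by ring.
  apply Hd; [lra | exact Hy].
Qed.

(** Carathéodory's form of differentiability: a continuous factor [s] stands in for the difference
    quotient, so no increment that might vanish is divided by. [slope], completed at the base point
    by the derivative, is the standard such factor. *)
Lemma is_derive_caratheodory (f s : R -> R) (x : R) :
  continuous s x -> (forall y, f y - f x = (y - x) * s y) -> is_derive f x (s x).
Proof.
intros Hs H; apply is_derive_Reals; intros eps Heps.
destruct (proj2 (continuous_eps s x) Hs eps Heps) as [d [Hd H1]].
exists (mkposreal d Hd); intros e ne He; simpl in He.
replace ((f (x + e) - f x) / e) with (s (x + e)).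
- apply H1; replace (x + e - x) with e by ring; exact He.
- rewrite H; field; exact ne.
Qed.

Lemma continuous_slope_ne (f : R -> R) (l x y : R) :
  y <> x -> continuous f y -> continuous (slope f l x) y.
Proof.
intros n Hf.
apply continuous_ext_loc with (fun z => (f z - f x) * / (z - x)).
- assert (Hd : 0 < Rabs (y - x)) by (apply Rabs_pos_lt; lra).
  exists (mkposreal _ Hd); intros z Hz; rewrite slope_ne; [reflexivity|].
  intros ->; change (Rabs (x - y) < Rabs (y - x)) in Hz.
  rewrite Rabs_minus_sym in Hz; lra.
- apply (continuous_mult (fun z => f z - f x) (fun z => / (z - x))).
  + apply (continuous_minus f (fun _ => f x)); [exact Hf | apply continuous_const].
  + apply continuous_Rinv_comp; [|lra].
    apply (continuous_minus (fun z => z) (fun _ => x));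
      [apply continuous_id | apply continuous_const].
Qed.

(** By the mean value theorem each difference quotient at [x] is a value of [df] between [x] and the
    second point, and [df] is continuous at [x]. This supplies the second derivative of a geodesic
    at its turning points. *)
Lemma derive_removable (f df : R -> R) (x d : R) :
  0 < d -> continuous f x -> continuous df x ->
  (forall y, 0 < Rabs (y - x) < d -> is_derive f y (df y)) ->
  is_derive f x (df x).
Proof.
intros Hd Hf Hdf H; apply is_derive_Reals; intros eps Heps.
destruct (proj2 (continuous_eps df x) Hdf eps Heps) as [e [He H1]].
assert (Hm : 0 < Rmin d e) by (apply Rmin_pos; assumption).
exists (mkposreal _ Hm); intros s ns Hs; simpl in Hs.
assert (Hs1 : Rabs s < d) by (eapply Rlt_le_trans; [exact Hs | apply Rmin_l]).
assert (Hs2 : Rabs s < e) by (eapply Rlt_le_trans; [exact Hs | apply Rmin_r]).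
assert (Hs3 : 0 < Rabs s) by (apply Rabs_pos_lt; exact ns).
assert (Hin : forall y, Rmin x (x + s) <= y <= Rmax x (x + s) -> Rabs (y - x) <= Rabs s).
{ intros y; unfold Rmin, Rmax; destruct (Rle_dec x (x + s)); intros Hy;
  unfold Rabs; destruct (Rcase_abs (y - x)), (Rcase_abs s); lra. }
destruct (MVT_gen f x (x + s) df) as [xi [Hxi Heq]].
- intros y Hy; apply H; split.
  + apply Rabs_pos_lt; intros Hyx; revert Hy; unfold Rmin, Rmax;
    destruct (Rle_dec x (x + s)); lra.
  + eapply Rle_lt_trans; [apply Hin; lra | exact Hs1].
- intros y Hy; destruct (Req_dec y x) as [->|n].
  + apply continuity_pt_filterlim, Hf.
  + apply continuity_pt_filterlim, (ex_derive_continuous f); exists (df y); apply H; split.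
    * apply Rabs_pos_lt; lra.
    * eapply Rle_lt_trans; [apply Hin; lra | exact Hs1].
- rewrite Heq; replace (df xi * (x + s - x) / s) with (df xi) by (field; exact ns).
  apply H1; eapply Rle_lt_trans; [apply Hin; exact Hxi | exact Hs2].
Qed.

(** A slope of at least [m] makes [f] expanding: hence onto the whole line, with an inverse that is
    Lipschitz with constant 1 / m. The derivative of the inverse then comes from the reciprocal of
    the Carathéodory factor of [f]. *)
Lemma inverse_function (f df : R -> R) (m : R) :
  0 < m -> (forall x, is_derive f x (df x)) -> (forall x, m <= df x) ->
  exists phi : R -> R, (forall t, f (phi t) = t) /\ (forall x, phi (f x) = x) /\
    forall t, is_derive phi t (/ df (phi t)).
Proof.
intros Hm Hf Hdf.
assert (Hcont : continuity f).
{ intros x; apply continuity_pt_filterlim, (ex_derive_continuous f); exists (df x); apply Hf. }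
assert (Hexp : forall x y, x <= y -> m * (y - x) <= f y - f x).
{ intros x y Hxy; destruct (MVT_gen f x y df) as [xi [_ ->]].
  - intros z _; apply Hf.
  - intros z _; apply Hcont.
  - apply Rmult_le_compat_r; [lra | apply Hdf]. }
assert (Hsurj : forall t, {x | f x = t}).
(* Expansion by the factor [m] over the length [K] covers the gap between [f 0] and [t], so f (- K)
   <= t <= f K. *)
{ intros t; set (K := Rabs (t - f 0) / m).
  assert (HK : 0 <= K) by (apply Rdiv_le_0_compat; [apply Rabs_pos | exact Hm]).
  assert (HmK : m * K = Rabs (t - f 0)) by (unfold K; field; lra).
  assert (H1 := Hexp 0 K HK); assert (H2 := Hexp (- K) 0 ltac:(lra)).
  assert (H3 := Rle_abs (t - f 0)); assert (H4 := Rle_abs (- (t - f 0))).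
  rewrite Rabs_Ropp in H4.
  destruct (IVT_gen f (- K) K t Hcont) as [x [_ Hx]].
  - rewrite Rmin_left, Rmax_right; nra.
  - exists x; exact Hx. }
set (phi := fun t => proj1_sig (Hsurj t)).
assert (Hphi : forall t, f (phi t) = t) by (intros t; exact (proj2_sig (Hsurj t))).
assert (Hlip : forall s t, Rabs (phi s - phi t) <= Rabs (s - t) / m).
{ intros s t; apply Rmult_le_reg_l with m; [exact Hm|].
  replace (m * (Rabs (s - t) / m)) with (Rabs (s - t)) by (field; lra).
  rewrite <- (Hphi s) at 2; rewrite <- (Hphi t) at 2.
  destruct (Rle_dec (phi t) (phi s)) as [l|l].
  - assert (H1 := Hexp _ _ l).
    rewrite !Rabs_pos_eq; nra.
  - assert (H1 := Hexp (phi s) (phi t) ltac:(lra)).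
    rewrite !Rabs_left1; nra. }
exists phi; split; [exact Hphi | split].
- intros x; destruct (Rle_dec (phi (f x)) x) as [l|l].
  + assert (H1 := Hexp _ _ l); rewrite Hphi in H1; nra.
  + assert (H1 := Hexp x (phi (f x)) ltac:(lra)); rewrite Hphi in H1; nra.
- intros t; set (x := phi t).
  assert (Hpos : forall y, m <= slope f (df x) x y).
  { intros y; destruct (Req_dec y x) as [->|n]; [rewrite slope_at; apply Hdf|].
    assert (H0 := slope_eq f (df x) x y).
    destruct (Rle_dec x y) as [l|l].
    - assert (H1 := Hexp _ _ l); rewrite H0 in H1; nra.
    - assert (H1 := Hexp y x ltac:(lra)).
      replace (f x - f y) with (- (f y - f x)) in H1 by ring; rewrite H0 in H1; nra. }
  assert (E : / df x = / slope f (df x) x (phi t)) by (fold x; rewrite slope_at; reflexivity).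
  rewrite E; apply (is_derive_caratheodory phi (fun s => / slope f (df x) x (phi s))).
  + apply continuous_Rinv_comp; [|specialize (Hpos (phi t)); lra].
    apply (continuous_comp phi (slope f (df x) x)); [|apply slope_continuous, Hf].
    apply continuous_eps; intros eps Heps; exists (m * eps); split; [nra|].
    intros s Hs; eapply Rle_lt_trans; [apply Hlip|].
    apply Rmult_lt_reg_l with m; [exact Hm|].
    replace (m * (Rabs (s - t) / m)) with (Rabs (s - t)) by (field; lra); exact Hs.
  + intros s; assert (H0 := slope_eq f (df x) x (phi s)).
    assert (Hx : f x = t) by apply Hphi.
    rewrite Hphi, Hx in H0; rewrite H0; fold x; field.
    specialize (Hpos (phi s)); lra.
Qed.

(** The two simple roots are divided out one after the other, each time by a [slope] completed with
    the derivative at the root. The signs of [la] and [lb] keep the quotient positive at the roots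
    themselves. It will be applied to h^2 - c^2. *)
Lemma two_root_factor (F : R -> R) (a b la lb : R) :
  a < b -> (forall u, a <= u <= b -> continuous F u) ->
  is_derive F a la -> is_derive F b lb -> 0 < la -> lb < 0 ->
  F a = 0 -> F b = 0 -> (forall u, a < u < b -> 0 < F u) ->
  exists Q : R -> R, forall u, a <= u <= b ->
    continuous Q u /\ 0 < Q u /\ F u = (u - a) * (b - u) * Q u.
Proof.
intros Hab Hc Ha Hb Hla Hlb Fa Fb Hpos.
set (S := slope F la a).
assert (HSb : S b = 0) by (unfold S; rewrite slope_ne, Fa, Fb by lra; field; lra).
assert (HSa : S a = la) by apply slope_at.
(* Near [b] the first quotient is F / (u - a), so the quotient rule gives its derivative there from
   F'(b) alone; no second derivative of [F] enters. *)
assert (HdS : is_derive S b (lb / (b - a))).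
{ apply is_derive_ext_loc with (fun z => F z / (z - a)).
  - assert (Hd : 0 < b - a) by lra; exists (mkposreal _ Hd); intros z Hz.
    change (Rabs (z - b) < b - a) in Hz; unfold S; rewrite slope_ne, Fa.
    + f_equal; ring.
    + intros ->; rewrite Rabs_left in Hz; lra.
  - evar_last.
    + apply (is_derive_div F (fun z => z - a) b lb 1); [exact Hb | auto_derive; [exact I | ring] | lra].
    + rewrite Fb; field; lra. }
set (T := slope S (lb / (b - a)) b).
assert (HQ : forall u, F u = (u - a) * (b - u) * - T u).
{ intros u; assert (H1 := slope_eq F la a u); assert (H2 := slope_eq S (lb / (b - a)) b u).
  fold S in H1; fold T in H2; rewrite Fa in H1; rewrite HSb in H2.
  replace (F u) with ((u - a) * S u) by lra; replace (S u) with ((u - b) * T u) by lra; ring. }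
exists (fun u => - T u); intros u Hu; split; [|split; [|apply HQ]].
- apply (continuous_opp T); unfold T.
  destruct (Req_dec u b) as [->|nb]; [apply slope_continuous, HdS|].
  apply continuous_slope_ne; [exact nb|]; unfold S.
  destruct (Req_dec u a) as [->|na]; [apply slope_continuous, Ha|].
  apply continuous_slope_ne; [exact na | apply Hc, Hu].
- destruct (Req_dec u b) as [->|nb].
  { unfold T; rewrite slope_at. replace (- (lb / (b - a))) with (- lb / (b - a)) by (field; lra).
    apply Rdiv_lt_0_compat; lra. }
  destruct (Req_dec u a) as [->|na].
  { unfold T; rewrite slope_ne, HSa, HSb by lra.
    replace (- ((la - 0) / (a - b))) with (la / (b - a)) by (field; lra).
    apply Rdiv_lt_0_compat; lra. }
  assert (H1 := Hpos u ltac:(lra)); rewrite HQ in H1.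
  assert (H2 : 0 < (u - a) * (b - u)) by (apply Rmult_lt_0_compat; lra).
  apply Rmult_lt_reg_l with ((u - a) * (b - u)); lra.
Qed.

(** Joint continuity along the compact segment over [c] is uniform. The 1 in [b - a + 1] allows a =
    b. *)
Lemma continuous_RInt_param (f : R -> R -> R) (a b c d : R) :
  a <= b -> 0 < d -> (forall x, a <= x <= b -> continuity_2d_pt f c x) ->
  (forall y, Rabs (y - c) < d -> ex_RInt (f y) a b) ->
  continuous (fun y => RInt (f y) a b) c.
Proof.
intros Hab Hd Hf Hex; apply continuous_eps; intros eps Heps.
assert (He : 0 < eps / (b - a + 1)) by (apply Rdiv_lt_0_compat; lra).
destruct (uniform_continuity_2d_1d' f a b c Hf (mkposreal _ He)) as [e H]; simpl in H.
exists (Rmin d e); split; [apply Rmin_pos; [exact Hd | apply cond_pos]|].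
intros y Hy.
assert (Hy1 : Rabs (y - c) < d) by (eapply Rlt_le_trans; [exact Hy | apply Rmin_l]).
assert (Hy2 : Rabs (y - c) < e) by (eapply Rlt_le_trans; [exact Hy | apply Rmin_r]).
assert (Hc0 : Rabs (c - c) < d) by (replace (c - c) with 0 by ring; rewrite Rabs_R0; exact Hd).
rewrite <- (RInt_minus (f y) (f c)); [|apply Hex; assumption..].
assert (He0 := cond_pos e); assert (Hy3 := Rabs_def2 _ _ Hy2).
apply Rle_lt_trans with ((b - a) * (eps / (b - a + 1))).
- apply abs_RInt_le_const; [exact Hab | apply (ex_RInt_minus (f y) (f c)); apply Hex; assumption|].
  intros x Hx; apply Rlt_le, (H x c x y); try lra.
  replace (x - x) with 0 by ring; rewrite Rabs_R0; exact He0.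
- apply Rmult_lt_reg_r with (b - a + 1); [lra|].
  replace ((b - a) * (eps / (b - a + 1)) * (b - a + 1)) with ((b - a) * eps) by (field; lra).
  nra.
Qed.

(** * The geodesic equation on a surface of revolution *)

Lemma is_derive_mul_cos (H V : R -> R) (t dH dV : R) :
  is_derive H t dH -> is_derive V t dV ->
  is_derive (fun s => H s * cos (V s)) t (dH * cos (V t) - H t * sin (V t) * dV).
Proof.
intros h1 h2; auto_derive.
- split; [exists dH; exact h1 | split; [exists dV; exact h2 | exact I]].
- change (Derive (fun x => H x) t) with (Derive H t).
  change (Derive (fun x => V x) t) with (Derive V t).
  rewrite (is_derive_unique _ _ _ h1), (is_derive_unique _ _ _ h2); ring.
Qed.

Lemma is_derive_mul_sin (H V : R -> R) (t dH dV : R) :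
  is_derive H t dH -> is_derive V t dV ->
  is_derive (fun s => H s * sin (V s)) t (dH * sin (V t) + H t * cos (V t) * dV).
Proof.
intros h1 h2; auto_derive.
- split; [exists dH; exact h1 | split; [exists dV; exact h2 | exact I]].
- change (Derive (fun x => H x) t) with (Derive H t).
  change (Derive (fun x => V x) t) with (Derive V t).
  rewrite (is_derive_unique _ _ _ h1), (is_derive_unique _ _ _ h2); ring.
Qed.

Lemma is_derive_compR (f u : R -> R) (t df du : R) :
  is_derive f (u t) df -> is_derive u t du -> is_derive (fun s => f (u s)) t (df * du).
Proof.
intros h1 h2; evar_last; [apply (is_derive_comp f u t df du h1 h2)|].
unfold scal; simpl; unfold mult; simpl; ring.
Qed.

Lemma is_derive_mulR (f u : R -> R) (t df du : R) :
  is_derive f t df -> is_derive u t du ->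
  is_derive (fun s => f s * u s) t (df * u t + f t * du).
Proof.
intros h1 h2; apply (is_derive_mult f u t df du h1 h2); intros; apply Rmult_comm.
Qed.

Lemma Derive3_is (c : R -> R3) (t x y z : R) :
  is_derive (fun s => px (c s)) t x -> is_derive (fun s => py (c s)) t y ->
  is_derive (fun s => pz (c s)) t z -> ex_derive3 c t /\ Derive3 c t = (x, y, z).
Proof.
intros hx hy hz; split.
- split; [exists x; exact hx | split; [exists y; exact hy | exists z; exact hz]].
- unfold Derive3; f_equal; [f_equal|]; apply is_derive_unique; assumption.
Qed.

Definition speed2 (g h : R -> R) (u : R) : R := Derive g u ^ 2 + Derive h u ^ 2.

Lemma Derive3_revolution (g h U V : R -> R) (t dU dV : R) :
  ex_derive g (U t) -> ex_derive h (U t) -> is_derive U t dU -> is_derive V t dV ->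
  ex_derive3 (fun s => revolution g h (U s) (V s)) t /\
  Derive3 (fun s => revolution g h (U s) (V s)) t =
    (Derive g (U t) * dU,
     Derive h (U t) * dU * cos (V t) - h (U t) * sin (V t) * dV,
     Derive h (U t) * dU * sin (V t) + h (U t) * cos (V t) * dV).
Proof.
intros hg hh hU hV; apply Derive3_is; unfold revolution, px, py, pz; simpl.
- apply (is_derive_compR g U); [apply Derive_correct, hg | exact hU].
- apply (is_derive_mul_cos (fun s => h (U s))); [|exact hV].
  apply (is_derive_compR h U); [apply Derive_correct, hh | exact hU].
- apply (is_derive_mul_sin (fun s => h (U s))); [|exact hV].
  apply (is_derive_compR h U); [apply Derive_correct, hh | exact hU].
Qed.

(** The last two equations say that the second derivative of the curve has no component along the u-
    and v-directions of the surface; the second one is divided by h and is the derivative of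
    Clairaut's relation. *)
Lemma geodesic_revolution (g h : R -> R) (uN uS : R) (U V dU dV ddU ddV : R -> R) :
  (forall t, uN < U t < uS) ->
  (forall t, ex_derive g (U t) /\ ex_derive (Derive g) (U t)) ->
  (forall t, ex_derive h (U t) /\ ex_derive (Derive h) (U t)) ->
  (forall t, is_derive U t (dU t)) -> (forall t, is_derive dU t (ddU t)) ->
  (forall t, is_derive V t (dV t)) -> (forall t, is_derive dV t (ddV t)) ->
  (forall t, speed2 g h (U t) * dU t ^ 2 + h (U t) ^ 2 * dV t ^ 2 = 1) ->
  (forall t, speed2 g h (U t) * ddU t
     + (Derive g (U t) * Derive (Derive g) (U t)
        + Derive h (U t) * Derive (Derive h) (U t)) * dU t ^ 2
     = h (U t) * Derive h (U t) * dV t ^ 2) ->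
  (forall t, 2 * Derive h (U t) * dU t * dV t + h (U t) * ddV t = 0) ->
  geodesic g h uN uS (fun t => revolution g h (U t) (V t)).
Proof.
intros Hdom Hg Hh HU HdU HV HdV Hspeed Heq1 Heq2.
set (c := fun t => revolution g h (U t) (V t)).
assert (H1 : forall t, ex_derive3 c t /\ Derive3 c t =
    (Derive g (U t) * dU t,
     Derive h (U t) * dU t * cos (V t) - h (U t) * sin (V t) * dV t,
     Derive h (U t) * dU t * sin (V t) + h (U t) * cos (V t) * dV t)).
{ intros t; apply Derive3_revolution; [apply Hg | apply Hh | apply HU | apply HV]. }
assert (Hh1 : forall t, is_derive (fun s => h (U s)) t (Derive h (U t) * dU t)).
{ intros t; apply (is_derive_compR h U); [apply Derive_correct, Hh | apply HU]. }
assert (H2 : forall (f : R -> R), (forall t, ex_derive (Derive f) (U t)) -> forall t,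
  is_derive (fun s => Derive f (U s) * dU s) t
    (Derive (Derive f) (U t) * dU t ^ 2 + Derive f (U t) * ddU t)).
{ intros f Hf t; evar_last.
  - apply (is_derive_mulR (fun s => Derive f (U s)) dU); [|apply HdU].
    apply (is_derive_compR (Derive f) U); [apply Derive_correct, Hf | apply HU].
  - simpl; ring. }
assert (Hg2 := H2 g (fun t => proj2 (Hg t))); assert (Hh2 := H2 h (fun t => proj2 (Hh t))).
assert (HVd : forall t, is_derive (fun s => h (U s) * dV s) t
   (Derive h (U t) * dU t * dV t + h (U t) * ddV t)).
{ intros t; apply (is_derive_mulR (fun s => h (U s)) dV); [apply Hh1 | apply HdV]. }
assert (H3 : forall t, ex_derive3 (Derive3 c) t /\ Derive3 (Derive3 c) t =
    (Derive (Derive g) (U t) * dU t ^ 2 + Derive g (U t) * ddU t,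
     (Derive (Derive h) (U t) * dU t ^ 2 + Derive h (U t) * ddU t) * cos (V t)
       - Derive h (U t) * dU t * sin (V t) * dV t
       - ((Derive h (U t) * dU t * dV t + h (U t) * ddV t) * sin (V t)
          + h (U t) * dV t * cos (V t) * dV t),
     (Derive (Derive h) (U t) * dU t ^ 2 + Derive h (U t) * ddU t) * sin (V t)
       + Derive h (U t) * dU t * cos (V t) * dV t
       + ((Derive h (U t) * dU t * dV t + h (U t) * ddV t) * cos (V t)
          - h (U t) * dV t * sin (V t) * dV t))).
{ intros t; apply Derive3_is.
  - apply is_derive_ext with (fun s => Derive g (U s) * dU s); [|apply Hg2].
    intros s; rewrite (proj2 (H1 s)); reflexivity.
  - apply is_derive_ext with (fun s => Derive h (U s) * dU s * cos (V s) - h (U s) * dV s * sin (V s)).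
    { intros s; rewrite (proj2 (H1 s)); unfold py; simpl; ring. }
    apply (is_derive_minus (fun s => Derive h (U s) * dU s * cos (V s))
             (fun s => h (U s) * dV s * sin (V s))).
    + apply (is_derive_mul_cos (fun s => Derive h (U s) * dU s)); [apply Hh2 | apply HV].
    + apply (is_derive_mul_sin (fun s => h (U s) * dV s)); [apply HVd | apply HV].
  - apply is_derive_ext with (fun s => Derive h (U s) * dU s * sin (V s) + h (U s) * dV s * cos (V s)).
    { intros s; rewrite (proj2 (H1 s)); unfold pz; simpl; ring. }
    apply (is_derive_plus (fun s => Derive h (U s) * dU s * sin (V s))
             (fun s => h (U s) * dV s * cos (V s))).
    + apply (is_derive_mul_sin (fun s => Derive h (U s) * dU s)); [apply Hh2 | apply HV].
    + apply (is_derive_mul_cos (fun s => h (U s) * dV s)); [apply HVd | apply HV]. }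
assert (Hcs : forall x, cos x ^ 2 = 1 - sin x ^ 2).
{ intros x; assert (H := sin2_cos2 x); unfold Rsqr in H; lra. }
split; [intros t; apply H1 | split; [intros t; apply H3 | split]].
- intros t; rewrite (proj2 (H1 t)); unfold dot, px, py, pz; simpl.
  rewrite <- (Hspeed t); unfold speed2; ring_simplify; rewrite !Hcs; ring.
- intros t; exists (U t), (V t); split; [apply Hdom | split; [reflexivity|]].
  rewrite (proj2 (H3 t)).
  assert (Hu : Derive3 (fun s => revolution g h s (V t)) (U t) =
     (Derive g (U t), Derive h (U t) * cos (V t), Derive h (U t) * sin (V t))).
  { destruct (Derive3_revolution g h (fun s => s) (fun _ => V t) (U t) 1 0) as [_ ->].
    - apply Hg.
    - apply Hh.
    - apply (is_derive_id (U t)).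
    - apply (is_derive_const (V t)).
    - f_equal; [f_equal|]; ring. }
  assert (Hv : Derive3 (fun s => revolution g h (U t) s) (V t) =
     (0, - h (U t) * sin (V t), h (U t) * cos (V t))).
  { destruct (Derive3_revolution g h (fun _ => U t) (fun s => s) (V t) 0 1) as [_ ->].
    - apply Hg.
    - apply Hh.
    - apply (is_derive_const (U t)).
    - apply (is_derive_id (V t)).
    - f_equal; [f_equal|]; ring. }
  rewrite Hu, Hv; unfold dot, px, py, pz; simpl.
  assert (E1 := Heq1 t); assert (E2 := Heq2 t); assert (E3 := Hcs (V t)); unfold speed2 in E1.
  split.
  + transitivity ((Derive g (U t) ^ 2 + Derive h (U t) ^ 2) * ddU t
     + (Derive g (U t) * Derive (Derive g) (U t)
        + Derive h (U t) * Derive (Derive h) (U t)) * dU t ^ 2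
     - h (U t) * Derive h (U t) * dV t ^ 2).
    * ring_simplify; rewrite !E3; ring.
    * rewrite E1; ring.
  + transitivity (h (U t) * (2 * Derive h (U t) * dU t * dV t + h (U t) * ddV t)).
    * ring_simplify; rewrite !E3; ring.
    * rewrite E2; ring.
Qed.

(** * Oscillating geodesics *)

Lemma contR_plus (f k : R -> R) (x : R) :
  continuous f x -> continuous k x -> continuous (fun y => f y + k y) x.
Proof. intros; apply (continuous_plus f k); assumption. Qed.

Lemma contR_minus (f k : R -> R) (x : R) :
  continuous f x -> continuous k x -> continuous (fun y => f y - k y) x.
Proof. intros; apply (continuous_minus f k); assumption. Qed.

Lemma contR_mult (f k : R -> R) (x : R) :
  continuous f x -> continuous k x -> continuous (fun y => f y * k y) x.
Proof. intros; apply (continuous_mult f k); assumption. Qed.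

Lemma contR_div (f k : R -> R) (x : R) :
  continuous f x -> continuous k x -> k x <> 0 -> continuous (fun y => f y / k y) x.
Proof. intros; apply contR_mult; [|apply continuous_Rinv_comp]; assumption. Qed.

Lemma contR_pow (f : R -> R) (n : nat) (x : R) :
  continuous f x -> continuous (fun y => f y ^ n) x.
Proof.
intros H; induction n as [|n IH]; simpl; [apply continuous_const | apply contR_mult; assumption].
Qed.

Ltac cont_step :=
  match goal with
  | |- continuous (fun _ => ?c) _ => apply continuous_const
  | |- continuous (fun y => y) _ => apply continuous_id
  | |- continuous (fun y => _ + _) _ => apply contR_plus
  | |- continuous (fun y => _ - _) _ => apply contR_minus
  | |- continuous (fun y => _ * _) _ => apply contR_mult
  | |- continuous (fun y => _ / _) _ => apply contR_div
  | |- continuous (fun y => _ ^ _) _ => apply contR_pow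
  | |- continuous (fun y => sqrt _) _ => apply continuous_sqrt_comp
  | |- continuous sin _ => apply continuous_sin
  | |- continuous (fun y => cos _) _ => apply continuous_cos_comp
  | |- continuous (fun y => sin _) _ => apply continuous_sin_comp
  end.

(** Differentiability of [X] is a conclusion: continuity fixes the sign of [X] near [x], where it
    therefore equals sqrt S or - sqrt S. *)
Lemma derive_of_square (X S : R -> R) (x d : R) :
  continuous X x -> X x <> 0 -> (forall y, X y ^ 2 = S y) -> is_derive S x d ->
  is_derive X x (d / (2 * X x)).
Proof.
assert (Hpos : forall Y, continuous Y x -> 0 < Y x -> (forall y, Y y ^ 2 = S y) ->
  is_derive S x d -> is_derive Y x (d / (2 * Y x))).
{ intros Y HY HYx HS Hd.
  assert (Hloc : locally x (fun y => sqrt (S y) = Y y)).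
  { destruct (proj2 (continuous_eps Y x) HY (Y x) HYx) as [e [He H1]].
    exists (mkposreal e He); intros y Hy.
    assert (H2 := Rabs_def2 _ _ (H1 y Hy)).
    rewrite <- HS; apply sqrt_pow2; lra. }
  apply is_derive_ext_loc with (1 := Hloc); evar_last.
  - apply is_derive_sqrt; [exact Hd | rewrite <- HS; nra].
  - rewrite (locally_singleton _ _ Hloc); reflexivity. }
intros HX HXx HS Hd; destruct (Rtotal_order 0 (X x)) as [l|[e|l]].
- apply Hpos; assumption.
- congruence.
- apply is_derive_ext with (fun y => - - X y); [intros; apply Ropp_involutive|].
  evar_last.
  + apply (is_derive_opp (fun y => - X y)); apply (Hpos (fun y => - X y)).
    * apply (continuous_opp X), HX.
    * lra.
    * intros y; rewrite <- HS; ring.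
    * exact Hd.
  + unfold opp; simpl; field; lra.
Qed.

(** Under this substitution (u - a)(b - u) is the square of (b - a) / 2 * sin s, a root that changes
    sign by itself, so one formula covers the outward and the return passage. *)
Definition osc (a b s : R) : R := (a + b) / 2 - (b - a) / 2 * cos s.

(** This is dv / ds. With h^2 - c^2 = (u - a)(b - u) Q the factor du / ds = (b - a) / 2 * sin s
    cancels the vanishing part of the root, and the integral over [0, PI] is D(c). *)
Definition turn_rate (g h Q : R -> R) (a b c s : R) : R :=
  c * sqrt (speed2 g h (osc a b s)) / (h (osc a b s) * sqrt (Q (osc a b s))).

Lemma osc_bound (a b s : R) : a <= b -> a <= osc a b s <= b.
Proof. intros; unfold osc; assert (H1 := COS_bound s); split; nra. Qed.

Lemma is_derive_osc (a b s : R) : is_derive (osc a b) s ((b - a) / 2 * sin s).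
Proof. unfold osc; auto_derive; [exact I | ring]. Qed.

Lemma osc_prod (a b s : R) : (osc a b s - a) * (b - osc a b s) = ((b - a) / 2 * sin s) ^ 2.
Proof.
unfold osc; assert (H := sin2_cos2 s); unfold Rsqr in H.
replace (((b - a) / 2 * sin s) ^ 2) with (((b - a) / 2) ^ 2 * (1 - cos s * cos s))
  by (replace (1 - cos s * cos s) with (sin s * sin s) by lra; ring).
field.
Qed.

Lemma continuous_osc (f : R -> R) (a b s : R) : a <= b ->
  (forall u, a <= u <= b -> continuous f u) -> continuous (fun s => f (osc a b s)) s.
Proof.
intros Hab H; apply (continuous_comp (osc a b) f).
- apply (ex_derive_continuous (osc a b)); eexists; apply is_derive_osc.
- apply H, osc_bound, Hab.
Qed.

Lemma is_derive_primitive (f : R -> R) (x : R) :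
  (forall y, continuous f y) -> is_derive (fun y => RInt f 0 y) x (f x).
Proof.
intros Hf; apply (is_derive_RInt f (fun y => RInt f 0 y) 0 x); [|apply Hf].
apply filter_forall; intros y; apply (RInt_correct f 0 y), (ex_RInt_continuous f); intros; apply Hf.
Qed.

Lemma zero_derive_const (f : R -> R) (x y : R) :
  (forall z, is_derive f z 0) -> f x = f y.
Proof.
intros H; destruct (MVT_gen f y x (fun _ => 0)) as [z [_ Hz]].
- intros; apply H.
- intros w _; apply continuity_pt_filterlim, (ex_derive_continuous f); exists 0; apply H.
- lra.
Qed.

(** The return passage turns by as much as the outward one. Periodicity gives F (x + 2 PI) = F x + F
    (2 PI) for the primitive, evenness makes it odd, and x = - PI yields F (2 PI) = 2 F PI. *)
Lemma turn_periods (f : R -> R) (n : nat) :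
  (forall s, continuous f s) -> (forall s, f (s + 2 * PI) = f s) -> (forall s, f (- s) = f s) ->
  RInt f 0 (INR n * (2 * PI)) = INR n * (2 * RInt f 0 PI).
Proof.
intros Hc Hper Hev; set (F := (fun y => RInt f 0 y) : R -> R).
assert (HF : forall x, is_derive F x (f x)) by (intros; apply is_derive_primitive, Hc).
assert (F0 : F 0 = 0) by apply (RInt_point 0 f).
assert (Hsh : forall x, F (x + 2 * PI) = F x + F (2 * PI)).
{ intros x; assert (H : F (x + 2 * PI) - F x = F (0 + 2 * PI) - F 0).
  { apply (zero_derive_const (fun x => F (x + 2 * PI) - F x)); intros z; evar_last.
    - apply (is_derive_minus (fun x => F (x + 2 * PI)) F); [|apply HF].
      apply (is_derive_compR F (fun x => x + 2 * PI) z (f (z + 2 * PI)) 1); [apply HF|].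
      auto_derive; [exact I | ring].
    - rewrite Hper; unfold minus, plus, opp; simpl; ring. }
  rewrite F0, Rplus_0_l in H; lra. }
assert (Hodd : forall x, F (- x) = - F x).
{ intros x; assert (H : F (- x) + F x = F (- 0) + F 0).
  { apply (zero_derive_const (fun x => F (- x) + F x)); intros z; evar_last.
    - apply (is_derive_plus (fun x => F (- x)) F); [|apply HF].
      apply (is_derive_compR F (fun x => - x) z (f (- z)) (- 1)); [apply HF|].
      auto_derive; [exact I | ring].
    - rewrite Hev; unfold plus; simpl; ring. }
  rewrite Ropp_0, F0 in H; lra. }
assert (H2 : F (2 * PI) = 2 * F PI).
{ assert (H := Hsh (- PI)); rewrite Hodd in H; replace (- PI + 2 * PI) with PI in H by ring; lra. }
change (F (INR n * (2 * PI)) = INR n * (2 * F PI)); rewrite <- H2.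
induction n as [|n IH].
- simpl; rewrite !Rmult_0_l; exact F0.
- rewrite S_INR; replace ((INR n + 1) * (2 * PI)) with (INR n * (2 * PI) + 2 * PI) by ring.
  rewrite Hsh, IH; ring.
Qed.

Lemma turn_rate_continuous (g h Q : R -> R) (a b c s : R) : a <= b ->
  (forall u, a <= u <= b -> continuous (speed2 g h) u /\ continuous h u /\ 0 < h u /\
     continuous Q u /\ 0 < Q u) ->
  continuous (turn_rate g h Q a b c) s.
Proof.
intros Hab H; unfold turn_rate.
apply (continuous_osc (fun u => c * sqrt (speed2 g h u) / (h u * sqrt (Q u)))); [exact Hab|].
intros u Hu; destruct (H u Hu) as (H1 & H2 & H3 & H4 & H5); apply sqrt_lt_R0 in H5.
repeat cont_step; try assumption; nra.
Qed.

(* The substitution u = osc a b s resolves both square root singularities of the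
   Clairaut quadratures at the turning points. *)
Lemma oscillating_geodesic (g h Q : R -> R) (uN uS a b c : R) :
  uN < a -> a < b -> b < uS -> 0 < c ->
  (forall f, f = g \/ f = h -> forall u, a <= u <= b ->
     ex_derive f u /\ ex_derive (Derive f) u /\ continuous (Derive (Derive f)) u) ->
  (forall u, a <= u <= b -> 0 < speed2 g h u) ->
  (forall u, a <= u <= b -> c <= h u) -> h a = c ->
  (forall u, a <= u <= b ->
     continuous Q u /\ 0 < Q u /\ h u ^ 2 - c ^ 2 = (u - a) * (b - u) * Q u) ->
  exists gam : R -> R3, geodesic g h uN uS gam /\
    (forall t, c ^ 2 <= py (gam t) ^ 2 + pz (gam t) ^ 2) /\
    (exists t, py (gam t) ^ 2 + pz (gam t) ^ 2 = c ^ 2) /\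
    (forall n p : nat, (0 < n)%nat ->
       INR n * RInt (turn_rate g h Q a b c) 0 PI = INR p * PI ->
       closed_geodesic g h uN uS gam).
Proof.
intros HN Hab HS Hc Hsm HE Hhc Hha HQ.
assert (Hsg : forall u, a <= u <= b ->
  ex_derive g u /\ ex_derive (Derive g) u /\ continuous (Derive (Derive g)) u).
{ apply Hsm; left; reflexivity. }
assert (Hsh : forall u, a <= u <= b ->
  ex_derive h u /\ ex_derive (Derive h) u /\ continuous (Derive (Derive h)) u).
{ apply Hsm; right; reflexivity. }
assert (Ho : forall s, a <= osc a b s <= b) by (intros; apply osc_bound; lra).
set (E := speed2 g h).
(* The rate ds / dt: Clairaut's relation and unit speed give E (du / dt)^2 = 1 - c^2 / h^2 = (u -
   a)(b - u) Q / h^2, and dividing the root by du / ds leaves [k]. *)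
set (k := fun u => sqrt (Q u) / (h u * sqrt (E u))).
assert (Hsgn : forall u, a <= u <= b -> 0 < h u /\ 0 < E u /\ 0 < Q u /\ 0 < sqrt (E u) /\ 0 < sqrt (Q u)).
{ intros u Hu; assert (H1 := Hhc u Hu); assert (H2 := HE u Hu).
  destruct (HQ u Hu) as [_ [H3 _]].
  repeat split; try assumption; [lra | apply sqrt_lt_R0, H2 | apply sqrt_lt_R0, H3]. }
assert (Hch : forall u, a <= u <= b -> continuous h u).
{ intros; apply (ex_derive_continuous h), Hsh; assumption. }
assert (Hch1 : forall u, a <= u <= b -> continuous (Derive h) u).
{ intros; apply (ex_derive_continuous (Derive h)), Hsh; assumption. }
assert (Hcg1 : forall u, a <= u <= b -> continuous (Derive g) u).
{ intros; apply (ex_derive_continuous (Derive g)), Hsg; assumption. }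
assert (HcE : forall u, a <= u <= b -> continuous E u).
{ intros u Hu; unfold E, speed2; repeat cont_step; auto. }
assert (Hck : forall u, a <= u <= b -> continuous k u).
{ intros u Hu; destruct (Hsgn u Hu) as (H1 & H2 & H3 & H4 & H5).
  unfold k; repeat cont_step; auto; [apply HQ, Hu | nra]. }
assert (Hkpos : forall u, a <= u <= b -> 0 < k u).
{ intros u Hu; destruct (Hsgn u Hu) as (H1 & H2 & H3 & H4 & H5).
  unfold k; apply Rdiv_lt_0_compat; [assumption | nra]. }
assert (HcP : forall s, continuous (fun s => / k (osc a b s)) s).
{ intros s; apply continuous_Rinv_comp.
  - apply continuous_osc; [lra | exact Hck].
  - assert (H := Hkpos _ (Ho s)); lra. }
destruct (continuity_ab_maj k a b) as [M [HM HMab]].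
{ lra. }
{ intros u Hu; apply continuity_pt_filterlim, Hck, Hu. }
assert (HkM := Hkpos M HMab).
(* Time is a primitive of 1 / k in s. Its slope is at least 1 / k M, with k M the maximum, so it can
   be inverted on the whole line and the geodesic is complete. *)
destruct (inverse_function (fun y => RInt (fun s => / k (osc a b s)) 0 y)
   (fun s => / k (osc a b s)) (/ k M)) as [th [Hth1 [Hth2 Hth3]]].
{ apply Rinv_0_lt_compat, HkM. }
{ intros x; apply (is_derive_primitive (fun s => / k (osc a b s))), HcP. }
{ intros x; apply Rinv_le_contravar; [apply Hkpos, Ho | apply HM, Ho]. }
set (T := (fun y => RInt (fun s => / k (osc a b s)) 0 y) : R -> R) in *.
assert (Hth : forall t, is_derive th t (k (osc a b (th t)))).
{ intros t; assert (H := Hth3 t); cbv beta in H; rewrite Rinv_inv in H; exact H. }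
set (f := turn_rate g h Q a b c).
assert (Hcf : forall s, continuous f s).
{ intros s; apply turn_rate_continuous; [lra|]; intros u Hu.
  split; [apply HcE, Hu | split; [apply Hch, Hu | split; [apply Hsgn, Hu | split; apply HQ, Hu]]]. }
set (U := fun t => osc a b (th t)); set (V := (fun t => RInt f 0 (th t)) : R -> R).
assert (HUab : forall t, a <= U t <= b) by (intros; apply Ho).
(* [X] is dU / dt expressed in s. Its square depends on the profile parameter alone, through [W]. *)
set (X := fun s => (b - a) / 2 * sin s * k (osc a b s)).
assert (HcX : forall s, continuous X s).
{ intros s; unfold X; apply contR_mult; [repeat cont_step | apply continuous_osc; [lra | exact Hck]]. }
set (W := fun u => (1 - c ^ 2 / h u ^ 2) / E u).
set (dW := fun u => (2 * c ^ 2 * Derive h u / h u ^ 3) / E u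
   - (1 - c ^ 2 / h u ^ 2) * (2 * (Derive g u * Derive (Derive g) u
       + Derive h u * Derive (Derive h) u)) / E u ^ 2).
assert (HXW : forall s, X s ^ 2 = W (osc a b s)).
{ intros s; destruct (Hsgn _ (Ho s)) as (H1 & H2 & H3 & H4 & H5).
  destruct (HQ _ (Ho s)) as (_ & _ & H6); rewrite osc_prod in H6.
  unfold X, W, k; set (u := osc a b s) in *.
  assert (H7 := pow2_sqrt (Q u) (Rlt_le _ _ H3)); assert (H8 := pow2_sqrt (E u) (Rlt_le _ _ H2)).
  transitivity (((b - a) / 2 * sin s) ^ 2 * sqrt (Q u) ^ 2 / (h u ^ 2 * sqrt (E u) ^ 2)); [field; lra|].
  rewrite H7, H8, <- H6; field; lra. }
assert (HdW : forall u, a <= u <= b -> is_derive W u (dW u)).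
{ intros u Hu; destruct (Hsgn u Hu) as (H1 & H2 & _).
  destruct (Hsg u Hu) as (H3 & H4 & _); destruct (Hsh u Hu) as (H5 & H6 & _).
  unfold W, dW, E, speed2 in *; auto_derive.
  - repeat split; auto; simpl in *; nra.
  - field_simplify_eq; [|simpl in *; nra].
    change (Derive (fun x => h x) u) with (Derive h u).
    change (Derive (fun x => Derive h x) u) with (Derive (Derive h) u).
    change (Derive (fun x => Derive g x) u) with (Derive (Derive g) u).
    ring. }
assert (HcdW : forall u, a <= u <= b -> continuous dW u).
{ intros u Hu; destruct (Hsgn u Hu) as (H1 & H2 & _).
  assert (H3 := proj2 (proj2 (Hsg u Hu))); assert (H4 := proj2 (proj2 (Hsh u Hu))).
  unfold dW; repeat cont_step; try assumption; try apply pow_nonzero;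
  match goal with |- _ <> _ => lra | _ => auto end. }
(* [X] contains sqrt Q, and [Q] is only known to be continuous, so [X] is not differentiated
   directly. Instead X^2 = W (osc a b s) gives 2 X X' = W' * (b - a) / 2 * sin s, and sin s cancels,
   leaving the continuous [Z]. *)
set (Z := fun s => dW (osc a b s) / (2 * k (osc a b s))).
assert (HcZ : forall s, continuous Z s).
{ intros s; unfold Z; apply (continuous_osc (fun u => dW u / (2 * k u))); [lra|].
  intros u Hu; assert (H := Hkpos u Hu); repeat cont_step; [auto | auto | lra]. }
assert (HX1 : forall s, sin s <> 0 -> is_derive X s (Z s)).
{ intros s Hs; assert (Hk := Hkpos _ (Ho s)).
  assert (HXs : X s <> 0) by (unfold X; apply Rmult_integral_contrapositive_currified;
    [apply Rmult_integral_contrapositive_currified; [lra | exact Hs] | lra]).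
  replace (Z s) with (dW (osc a b s) * ((b - a) / 2 * sin s) / (2 * X s)).
  - apply derive_of_square with (fun s => W (osc a b s)); [apply HcX | exact HXs | exact HXW|].
    apply (is_derive_compR W (osc a b)); [apply HdW, Ho | apply is_derive_osc].
  - unfold Z, X; field; repeat split; lra. }
assert (HX : forall s, is_derive X s (Z s)).
{ intros s; destruct (Req_dec (sin s) 0) as [e|n]; [|apply HX1, n].
  (* Division by X fails only at zeros of sin, the turning points, and no other zero lies closer
     than PI. *)
  apply derive_removable with PI; [apply PI_RGT_0 | apply HcX | apply HcZ|].
  intros y Hy; apply HX1; intros Hsy.
  assert (H0 : sin (y - s) = 0) by (rewrite sin_minus, e, Hsy; ring).
  unfold Rabs in Hy; destruct (Rcase_abs (y - s)).
  - assert (H := sin_gt_0 (- (y - s))); rewrite sin_neg in H; lra.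
  - assert (H := sin_gt_0 (y - s)); lra. }
assert (HdU : forall t, is_derive U t (X (th t))).
{ intros t; unfold U, X; apply (is_derive_compR (osc a b) th); [apply is_derive_osc | apply Hth]. }
assert (HddU : forall t, is_derive (fun t => X (th t)) t (dW (U t) / 2)).
{ intros t; evar_last; [apply (is_derive_compR X th); [apply HX | apply Hth]|].
  assert (H := Hkpos _ (Ho (th t))); unfold Z, U; field; lra. }
assert (HdV : forall t, is_derive V t (c / h (U t) ^ 2)).
{ intros t; evar_last.
  - apply (is_derive_compR (fun y => RInt f 0 y) th); [apply is_derive_primitive, Hcf | apply Hth].
  - destruct (Hsgn _ (HUab t)) as (H1 & H2 & H3 & H4 & H5).
    unfold f, turn_rate, k; fold (U t); unfold E in *; field; lra. }
assert (HddV : forall t, is_derive (fun t => c / h (U t) ^ 2) t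
   (- 2 * c * Derive h (U t) / h (U t) ^ 3 * X (th t))).
{ intros t; apply (is_derive_compR (fun u => c / h u ^ 2) U); [|apply HdU].
  destruct (Hsgn _ (HUab t)) as (H1 & _); destruct (Hsh _ (HUab t)) as (H2 & _).
  auto_derive; [repeat split; auto; nra|].
  change (Derive (fun x => h x) (U t)) with (Derive h (U t)); field; lra. }
assert (Hgeo : geodesic g h uN uS (fun t => revolution g h (U t) (V t))).
{ apply geodesic_revolution with (fun t => X (th t)) (fun t => c / h (U t) ^ 2)
    (fun t => dW (U t) / 2)
    (fun t => - 2 * c * Derive h (U t) / h (U t) ^ 3 * X (th t)); try assumption.
  - intros t; assert (H := HUab t); lra.
  - intros t; split; apply Hsg, HUab.
  - intros t; split; apply Hsh, HUab.
  - intros t; cbv beta; rewrite HXW; fold (U t); destruct (Hsgn _ (HUab t)) as (H1 & H2 & _).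
    unfold W; fold (E (U t)); field; lra.
  - intros t; cbv beta; rewrite HXW; fold (U t); destruct (Hsgn _ (HUab t)) as (H1 & H2 & _).
    unfold W, dW; fold (E (U t)); field; lra.
  - intros t; cbv beta; destruct (Hsgn _ (HUab t)) as (H1 & _); field; lra. }
assert (Hr : forall u v, py (revolution g h u v) ^ 2 + pz (revolution g h u v) ^ 2 = h u ^ 2).
{ intros u v; unfold revolution, py, pz; simpl; assert (H := sin2_cos2 v); unfold Rsqr in H.
  transitivity (h u ^ 2 * (sin v * sin v + cos v * cos v)); [ring | rewrite H; ring]. }
assert (HT0 : T 0 = 0) by apply (RInt_point 0 (fun s => / k (osc a b s))).
assert (Hth0 : th 0 = 0) by (rewrite <- HT0 at 1; apply Hth2).
assert (Hosc0 : osc a b 0 = a) by (unfold osc; rewrite cos_0; field).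
exists (fun t => revolution g h (U t) (V t)); split; [exact Hgeo | split; [|split]].
- intros t; rewrite Hr; assert (H := Hhc _ (HUab t)); nra.
- exists 0; rewrite Hr; unfold U; rewrite Hth0, Hosc0, Hha; reflexivity.
- intros n p Hn Hnp; split; [exact Hgeo|].
  (* After [n] full oscillations, that is 2 n passages, the angle has grown by 2 n D(c) = 2 p PI,
     and both position and velocity recur. *)
  set (s1 := INR n * (2 * PI)).
  assert (Hn1 : 0 < INR n) by (apply lt_0_INR; exact Hn).
  assert (Hpi := PI_RGT_0).
  assert (Hs1 : 0 < s1) by (unfold s1; nra).
  assert (Hsin : forall m, sin (INR m * (2 * PI)) = 0).
  { intros m; replace (INR m * (2 * PI)) with (0 + 2 * INR m * PI) by ring.
    rewrite sin_period; apply sin_0. }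
  assert (Hcos : forall m, cos (INR m * (2 * PI)) = 1).
  { intros m; replace (INR m * (2 * PI)) with (0 + 2 * INR m * PI) by ring.
    rewrite cos_period; apply cos_0. }
  assert (Hosc1 : osc a b s1 = a) by (unfold osc, s1; rewrite Hcos; field).
  assert (HU0 : U 0 = a) by (unfold U; rewrite Hth0; exact Hosc0).
  assert (HU1 : U (T s1) = a) by (unfold U; rewrite (Hth2 s1 : th (T s1) = s1); exact Hosc1).
  assert (HV0 : V 0 = 0) by (unfold V; rewrite Hth0; apply (RInt_point 0 f)).
  assert (HV1 : V (T s1) = INR p * (2 * PI)).
  { unfold V; rewrite (Hth2 s1 : th (T s1) = s1); unfold s1; rewrite turn_periods.
    - transitivity (2 * (INR n * RInt f 0 PI)); [ring | rewrite Hnp; ring].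
    - exact Hcf.
    - intros s; unfold f, turn_rate, osc.
      replace (cos (s + 2 * PI)) with (cos s); [reflexivity|].
      rewrite <- (cos_period s 1); f_equal; simpl; ring.
    - intros s; unfold f, turn_rate, osc; rewrite cos_neg; reflexivity. }
  assert (HD : forall t, Derive3 (fun s => revolution g h (U s) (V s)) t =
    (Derive g (U t) * X (th t),
     Derive h (U t) * X (th t) * cos (V t) - h (U t) * sin (V t) * (c / h (U t) ^ 2),
     Derive h (U t) * X (th t) * sin (V t) + h (U t) * cos (V t) * (c / h (U t) ^ 2))).
  { intros t; apply Derive3_revolution; [apply Hsg, HUab | apply Hsh, HUab | apply HdU | apply HdV]. }
  exists 0, (T s1); split; [|split].
  + intros e; assert (H := Hth2 s1 : th (T s1) = s1); rewrite <- e, Hth0 in H; lra.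
  + unfold revolution; rewrite HU0, HU1, HV0, HV1, Hsin, Hcos, sin_0, cos_0; reflexivity.
  + rewrite !HD, HU0, HU1, HV0, HV1, Hsin, Hcos, sin_0, cos_0, Hth0, (Hth2 s1 : th (T s1) = s1).
    unfold X, s1; rewrite Hsin, sin_0, !Rmult_0_r, !Rmult_0_l; reflexivity.
Qed.

(** * The turning angle as a function of the Clairaut constant *)

(** This is why [bump] is squared: the positive part has a corner at 0, its square has a continuous
    derivative. The error is at most 2 e^2, so eps / 3 suffices as a radius. *)
Lemma is_derive_Rmax0_sq (x : R) : is_derive (fun z => Rmax 0 z ^ 2) x (2 * Rmax 0 x).
Proof.
apply is_derive_Reals; intros eps Heps.
assert (Hd : 0 < eps / 3) by lra.
exists (mkposreal _ Hd); intros e ne He; simpl in He.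
assert (Herr : Rabs (Rmax 0 (x + e) ^ 2 - Rmax 0 x ^ 2 - 2 * Rmax 0 x * e) <= 2 * Rabs e ^ 2).
{ rewrite RPow_abs, (Rabs_pos_eq (e ^ 2)) by apply pow2_ge_0.
  unfold Rmax; destruct (Rle_dec 0 (x + e)), (Rle_dec 0 x); apply Rabs_le; split; nra. }
replace ((Rmax 0 (x + e) ^ 2 - Rmax 0 x ^ 2) / e - 2 * Rmax 0 x)
  with ((Rmax 0 (x + e) ^ 2 - Rmax 0 x ^ 2 - 2 * Rmax 0 x * e) / e) by (field; exact ne).
unfold Rdiv; rewrite Rabs_mult, Rabs_inv.
assert (H0 : 0 < Rabs e) by (apply Rabs_pos_lt; exact ne).
apply Rmult_lt_reg_r with (Rabs e); [exact H0|].
rewrite Rmult_assoc, Rinv_l, Rmult_1_r by lra.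
eapply Rle_lt_trans; [exact Herr|]; nra.
Qed.

Lemma continuous_Rmax_comp (f : R -> R) (m x : R) :
  continuous f x -> continuous (fun z => Rmax m (f z)) x.
Proof.
intros H; apply continuous_eps; intros eps Heps.
destruct (proj2 (continuous_eps f x) H eps Heps) as [d [Hd H1]].
exists d; split; [exact Hd|]; intros z Hz; specialize (H1 z Hz).
apply Rabs_def2 in H1; unfold Rmax; destruct (Rle_dec m (f z)), (Rle_dec m (f x));
apply Rabs_def1; lra.
Qed.

Lemma cont2_snd (f : R -> R) (c u : R) : continuous f u -> continuity_2d_pt (fun _ v => f v) c u.
Proof.
intros H; apply (continuity_1d_2d_pt_comp f (fun _ v => v));
  [apply continuity_pt_filterlim, H | apply continuity_2d_pt_id2].
Qed.

Lemma cont2_comp (f : R -> R) (k : R -> R -> R) (c u : R) :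
  continuous f (k c u) -> continuity_2d_pt k c u -> continuity_2d_pt (fun x v => f (k x v)) c u.
Proof.
intros H; apply continuity_1d_2d_pt_comp, continuity_pt_filterlim, H.
Qed.

Lemma cont2_div (f k : R -> R -> R) (c u : R) : continuity_2d_pt f c u ->
  continuity_2d_pt k c u -> k c u <> 0 -> continuity_2d_pt (fun x v => f x v / k x v) c u.
Proof.
intros H1 H2 H3; apply continuity_2d_pt_mult; [|apply continuity_2d_pt_inv]; assumption.
Qed.

Lemma RInt_zero (f : R -> R) (a b : R) :
  a <= b -> (forall x, a <= x <= b -> f x = 0) -> RInt f a b = 0.
Proof.
intros Hab H; rewrite (RInt_ext f (fun _ => 0)).
- rewrite RInt_const; unfold scal; simpl; unfold mult; simpl; ring.
- intros x; rewrite Rmin_left, Rmax_right by exact Hab; intros Hx; apply H; lra.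
Qed.

(* sqrt E = weight * h' + rest with rest = 0 where h <= y.  As
   d/du half_turn = c h' / (h sqrt (h^2 - c^2)), integrating the weight part of
   D(c) by parts leaves the integral of [turn_density] over the fixed interval
   [uN, uS], whose integrand is jointly continuous in (c, u) for 0 < c < y. *)
Definition bump (h : R -> R) (y u : R) : R := Rmax 0 (h u - y) ^ 2.

Definition bump_den (h : R -> R) (y u : R) : R := Derive h u ^ 2 + bump h y u.

Definition weight (g h : R -> R) (y u : R) : R :=
  sqrt (speed2 g h u) * Derive h u / bump_den h y u.

Definition dweight (g h : R -> R) (y u : R) : R :=
  (((Derive g u * Derive (Derive g) u + Derive h u * Derive (Derive h) u) / sqrt (speed2 g h u)
      * Derive h u + sqrt (speed2 g h u) * Derive (Derive h) u) * bump_den h y u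
   - sqrt (speed2 g h u) * Derive h u
      * (2 * Derive h u * Derive (Derive h) u + 2 * Rmax 0 (h u - y) * Derive h u))
  / bump_den h y u ^ 2.

Definition rest (g h : R -> R) (y u : R) : R :=
  sqrt (speed2 g h u) * bump h y u / bump_den h y u.

(** For h >= c > 0 this is arccos (c / h), the angle swept by a straight line in the plane, in polar
    coordinates, from its nearest distance c to the distance h. In the atan form it is extended
    continuously by 0 to |h| <= c, because sqrt is 0 on negative numbers. *)
Definition half_turn (h : R -> R) (c u : R) : R := atan (sqrt (h u ^ 2 - c ^ 2) / c).

(** [Rmax y (h u)] keeps the denominator away from 0 for every u when 0 < c < y. Where it differs
    from [h u], the factor [rest] is 0. *)
Definition turn_density (g h : R -> R) (y c u : R) : R :=
  rest g h y u * (c / (Rmax y (h u) * sqrt (Rmax y (h u) ^ 2 - c ^ 2)))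
  - dweight g h y u * half_turn h c u.

Section Turn.

Variables (g h : R -> R) (uN uS y : R).
Hypothesis HNS : uN < uS.
Hypothesis Hsm : forall f, f = g \/ f = h -> forall u, uN <= u <= uS ->
  ex_derive f u /\ ex_derive (Derive f) u /\ continuous (Derive (Derive f)) u.
Hypothesis HE : forall u, uN <= u <= uS -> 0 < speed2 g h u.
Hypothesis Hy : 0 < y.
Hypothesis Hlow : forall u, uN <= u <= uS -> h u <= y -> Derive h u <> 0.

Lemma g_C2 : forall u, uN <= u <= uS ->
  ex_derive g u /\ ex_derive (Derive g) u /\ continuous (Derive (Derive g)) u.
Proof. apply Hsm; left; reflexivity. Qed.

Lemma h_C2 : forall u, uN <= u <= uS ->
  ex_derive h u /\ ex_derive (Derive h) u /\ continuous (Derive (Derive h)) u.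
Proof. apply Hsm; right; reflexivity. Qed.

Lemma h_continuous u : uN <= u <= uS -> continuous h u.
Proof. intros; apply (ex_derive_continuous h), h_C2; assumption. Qed.

Lemma Dg_continuous u : uN <= u <= uS -> continuous (Derive g) u.
Proof. intros; apply (ex_derive_continuous (Derive g)), g_C2; assumption. Qed.

Lemma Dh_continuous u : uN <= u <= uS -> continuous (Derive h) u.
Proof. intros; apply (ex_derive_continuous (Derive h)), h_C2; assumption. Qed.

Lemma speed2_continuous u : uN <= u <= uS -> continuous (speed2 g h) u.
Proof.
intros Hu; unfold speed2; repeat cont_step; [apply Dg_continuous, Hu | apply Dh_continuous, Hu].
Qed.

Lemma bump_continuous u : uN <= u <= uS -> continuous (bump h y) u.
Proof.
intros Hu; unfold bump; cont_step; apply (continuous_Rmax_comp (fun u => h u - y)).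
repeat cont_step; apply h_continuous, Hu.
Qed.

Lemma bump_low u : h u <= y -> bump h y u = 0.
Proof. intros H; unfold bump; rewrite Rmax_left by lra; ring. Qed.

(** The two summands never vanish together: h' has no zero where h <= y, and the bump is positive
    where h > y. *)
Lemma bump_den_pos u : uN <= u <= uS -> 0 < bump_den h y u.
Proof.
intros Hu; unfold bump_den; assert (H0 := pow2_ge_0 (Derive h u)).
destruct (Rle_dec (h u) y) as [l|l].
- assert (H := Hlow u Hu l); rewrite bump_low by exact l.
  assert (H1 := pow2_gt_0 _ H); lra.
- unfold bump; rewrite Rmax_right by lra; assert (0 < (h u - y) ^ 2) by nra; lra.
Qed.

Lemma bump_den_continuous u : uN <= u <= uS -> continuous (bump_den h y) u.
Proof.
intros Hu; unfold bump_den; repeat cont_step; [apply Dh_continuous, Hu | apply bump_continuous, Hu].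
Qed.

Lemma rest_continuous u : uN <= u <= uS -> continuous (rest g h y) u.
Proof.
intros Hu; assert (H := bump_den_pos u Hu); unfold rest; repeat cont_step;
  [apply speed2_continuous, Hu | apply bump_continuous, Hu | apply bump_den_continuous, Hu | lra].
Qed.

Lemma dweight_continuous u : uN <= u <= uS -> continuous (dweight g h y) u.
Proof.
intros Hu; assert (H := bump_den_pos u Hu); assert (H0 := sqrt_lt_R0 _ (HE u Hu)).
assert (H1 := Dg_continuous u Hu); assert (H2 := Dh_continuous u Hu).
assert (H3 := speed2_continuous u Hu); assert (H4 := bump_den_continuous u Hu).
assert (H5 := proj2 (proj2 (g_C2 u Hu))); assert (H6 := proj2 (proj2 (h_C2 u Hu))).
assert (H7 : continuous (fun u => Rmax 0 (h u - y)) u).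
{ apply (continuous_Rmax_comp (fun u => h u - y)); repeat cont_step; apply h_continuous, Hu. }
unfold dweight; repeat cont_step; try assumption; try apply pow_nonzero; lra.
Qed.

Lemma is_derive_weight u : uN <= u <= uS -> is_derive (weight g h y) u (dweight g h y u).
Proof.
intros Hu; assert (H := bump_den_pos u Hu); assert (H0 := sqrt_lt_R0 _ (HE u Hu)).
destruct (g_C2 u Hu) as (H1 & H2 & _); destruct (h_C2 u Hu) as (H3 & H4 & _).
assert (HdE : is_derive (speed2 g h) u
  (2 * (Derive g u * Derive (Derive g) u + Derive h u * Derive (Derive h) u))).
{ unfold speed2; auto_derive; [tauto|].
  change (Derive (fun x => Derive h x) u) with (Derive (Derive h) u).
  change (Derive (fun x => Derive g x) u) with (Derive (Derive g) u); ring. }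
assert (HdB : is_derive (bump h y) u (2 * Rmax 0 (h u - y) * Derive h u)).
{ unfold bump; apply (is_derive_compR (fun z => Rmax 0 z ^ 2) (fun u => h u - y));
    [apply is_derive_Rmax0_sq|].
  auto_derive; [tauto|].
  change (Derive (fun x => h x) u) with (Derive h u); ring. }
assert (HdD : is_derive (bump_den h y) u
  (2 * Derive h u * Derive (Derive h) u + 2 * Rmax 0 (h u - y) * Derive h u)).
{ unfold bump_den; apply (is_derive_plus (fun u => Derive h u ^ 2) (bump h y)); [|exact HdB].
  auto_derive; [tauto|].
  change (Derive (fun x => Derive h x) u) with (Derive (Derive h) u); ring. }
unfold weight; evar_last.
- apply (is_derive_div (fun u => sqrt (speed2 g h u) * Derive h u) (bump_den h y));
    [|exact HdD | lra].
  apply (is_derive_mulR (fun u => sqrt (speed2 g h u)) (Derive h)).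
  + apply is_derive_sqrt; [exact HdE | apply HE, Hu].
  + apply Derive_correct, H4.
- unfold dweight; field; lra.
Qed.

(** * Continuity of the turning angle in the Clairaut constant *)

Lemma half_turn_cont2 c u : 0 < c -> uN <= u <= uS -> continuity_2d_pt (half_turn h) c u.
Proof.
intros Hc Hu; unfold half_turn.
apply (cont2_comp atan (fun c u => sqrt (h u ^ 2 - c ^ 2) / c)); [apply continuous_atan|].
apply cont2_div; [|apply continuity_2d_pt_id1 | lra].
apply (cont2_comp sqrt (fun c u => h u ^ 2 - c ^ 2)); [apply continuous_sqrt|].
apply continuity_2d_pt_minus.
- apply (cont2_snd (fun u => h u ^ 2)); cont_step; apply h_continuous, Hu.
- apply (cont2_comp (fun c => c ^ 2) (fun c _ => c)); [repeat cont_step | apply continuity_2d_pt_id1].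
Qed.

Lemma Rmax_gap c u : 0 < c < y -> 0 < Rmax y (h u) * sqrt (Rmax y (h u) ^ 2 - c ^ 2).
Proof.
intros Hc; assert (H := Rmax_l y (h u)).
apply Rmult_lt_0_compat; [lra | apply sqrt_lt_R0; nra].
Qed.

Lemma turn_density_cont2 c u : 0 < c < y -> uN <= u <= uS ->
  continuity_2d_pt (turn_density g h y) c u.
Proof.
intros Hc Hu; unfold turn_density.
assert (Hm : continuous (fun u => Rmax y (h u)) u)
  by (apply continuous_Rmax_comp, h_continuous, Hu).
assert (H0 := Rmax_gap c u Hc).
apply continuity_2d_pt_minus; apply continuity_2d_pt_mult.
- apply (cont2_snd (rest g h y)), rest_continuous, Hu.
- apply cont2_div; [apply continuity_2d_pt_id1 | | lra].
  apply continuity_2d_pt_mult; [apply (cont2_snd (fun u => Rmax y (h u))), Hm|].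
  apply (cont2_comp sqrt (fun c u => Rmax y (h u) ^ 2 - c ^ 2)); [apply continuous_sqrt|].
  apply continuity_2d_pt_minus.
  + apply (cont2_snd (fun u => Rmax y (h u) ^ 2)); cont_step; exact Hm.
  + apply (cont2_comp (fun c => c ^ 2) (fun c _ => c)); [repeat cont_step | apply continuity_2d_pt_id1].
- apply (cont2_snd (dweight g h y)), dweight_continuous, Hu.
- apply half_turn_cont2; [lra | exact Hu].
Qed.

Lemma turn_density_continuous c u : 0 < c < y -> uN <= u <= uS ->
  continuous (turn_density g h y c) u.
Proof.
intros Hc Hu; apply continuous_eps; intros eps Heps.
destruct (turn_density_cont2 c u Hc Hu (mkposreal eps Heps)) as [d Hd].
exists d; split; [apply cond_pos|]; intros z Hz; apply Hd; [|exact Hz].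
replace (c - c) with 0 by ring; rewrite Rabs_R0; apply cond_pos.
Qed.

Lemma turn_density_ex_RInt c u v : 0 < c < y -> uN <= u <= uS -> uN <= v <= uS ->
  ex_RInt (turn_density g h y c) u v.
Proof.
intros Hc Hu Hv; apply (ex_RInt_continuous (turn_density g h y c)); intros z Hz.
apply turn_density_continuous; [exact Hc|].
revert Hz; unfold Rmin, Rmax; destruct (Rle_dec u v); lra.
Qed.

Lemma turn_continuous c : 0 < c < y ->
  continuous (fun c => RInt (turn_density g h y c) uN uS) c.
Proof.
intros Hc.
assert (Hd : 0 < Rmin c (y - c)) by (apply Rmin_pos; lra).
apply continuous_RInt_param with (Rmin c (y - c)); [lra | exact Hd | |].
- intros; apply turn_density_cont2; assumption.
- intros z Hz; apply turn_density_ex_RInt; [|lra..].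
  assert (H1 := Rmin_l c (y - c)); assert (H2 := Rmin_r c (y - c)).
  apply Rabs_def2 in Hz; lra.
Qed.

(** * The turning angle as an integral over the whole profile *)

Lemma is_derive_half_turn c u : 0 < c -> c < h u -> uN <= u <= uS ->
  is_derive (half_turn h c) u (c * Derive h u / (h u * sqrt (h u ^ 2 - c ^ 2))).
Proof.
intros Hc Hcu Hu; assert (H0 : 0 < h u ^ 2 - c ^ 2) by nra.
assert (H1 := sqrt_lt_R0 _ H0); assert (H2 := pow2_sqrt _ (Rlt_le _ _ H0)).
unfold half_turn; evar_last.
- apply (is_derive_compR atan (fun u => sqrt (h u ^ 2 - c ^ 2) / c)); [apply is_derive_atan|].
  apply (is_derive_mulR (fun u => sqrt (h u ^ 2 - c ^ 2)) (fun _ => / c));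
    [|apply (is_derive_const (/ c))].
  apply is_derive_sqrt; [|exact H0].
  apply (is_derive_minus (fun u => h u ^ 2) (fun _ => c ^ 2)); [|apply (is_derive_const (c ^ 2))].
  apply (is_derive_pow h 2), Derive_correct, h_C2, Hu.
- unfold zero, minus, plus, opp; simpl; unfold Rsqr.
  replace (h u * (h u * 1) - c * (c * 1)) with (h u ^ 2 - c ^ 2) by ring.
  set (w := sqrt (h u ^ 2 - c ^ 2)) in *.
  replace (1 + w / c * (w / c)) with (h u ^ 2 / c ^ 2) by (field_simplify_eq; [rewrite H2; ring | lra]).
  field; lra.
Qed.

Lemma weight_rest u : uN <= u <= uS ->
  weight g h y u * Derive h u + rest g h y u = sqrt (speed2 g h u).
Proof.
intros Hu; assert (H := bump_den_pos u Hu).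
unfold weight, rest; transitivity (sqrt (speed2 g h u) * bump_den h y u / bump_den h y u).
- unfold bump_den at 3; field; lra.
- field; lra.
Qed.

(* On the support of [rest], [Rmax y h] is [h]. *)
Lemma rest_Rmax u (F : R -> R) : rest g h y u * F (Rmax y (h u)) = rest g h y u * F (h u).
Proof.
destruct (Rle_dec (h u) y) as [l|l].
- unfold rest; rewrite bump_low by exact l; unfold Rdiv; ring.
- rewrite Rmax_right by lra; reflexivity.
Qed.

Lemma half_turn_low c u : - c <= h u <= c -> half_turn h c u = 0.
Proof.
intros H; unfold half_turn; rewrite sqrt_neg_0 by nra; unfold Rdiv; rewrite Rmult_0_l; apply atan_0.
Qed.

(** The integration by parts is carried out in s: a function [F] collecting both sides has
    derivative 0 on the open interval (0, PI). At its ends, where [half_turn] is not differentiable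
    in u, the mean value theorem asks only for continuity. The boundary terms vanish because
    [half_turn] is 0 where h = c. *)
Lemma turn_formula (Q : R -> R) (a b c : R) :
  0 < c < y -> uN < a -> a < b -> b < uS ->
  (forall u, uN <= u <= a -> - c <= h u <= c) -> (forall u, b <= u <= uS -> - c <= h u <= c) ->
  (forall u, a < u < b -> c < h u) -> h a = c -> h b = c ->
  (forall u, a <= u <= b ->
     continuous Q u /\ 0 < Q u /\ h u ^ 2 - c ^ 2 = (u - a) * (b - u) * Q u) ->
  RInt (turn_rate g h Q a b c) 0 PI = RInt (turn_density g h y c) uN uS.
Proof.
intros Hc HN Hab HS Hl Hr Hm Ha Hb HQ.
assert (Hpi := PI_RGT_0).
set (G := turn_density g h y c); set (f := turn_rate g h Q a b c).
set (I := (fun u => RInt G uN u) : R -> R); set (v := (fun s => RInt f 0 s) : R -> R).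
assert (Ho : forall s, a <= osc a b s <= b) by (intros; apply osc_bound; lra).
assert (Hhpos : forall u, a <= u <= b -> 0 < h u).
{ intros u Hu; destruct (Req_dec u a) as [->|na]; [lra|].
  destruct (Req_dec u b) as [->|nb]; [lra|]. assert (H := Hm u ltac:(lra)); lra. }
assert (Hf : forall s, continuous f s).
{ intros s; apply turn_rate_continuous; [lra|]; intros u Hu.
  split; [apply speed2_continuous; lra | split; [apply h_continuous; lra|]].
  split; [apply Hhpos, Hu | split; apply HQ, Hu]. }
assert (HI : forall u, a <= u <= b -> is_derive I u (G u)).
{ intros u Hu; apply (is_derive_RInt G I uN u); [|apply turn_density_continuous; lra].
  assert (He : 0 < Rmin (u - uN) (uS - u)) by (apply Rmin_pos; lra).
  exists (mkposreal _ He); intros z Hz; change (Rabs (z - u) < Rmin (u - uN) (uS - u)) in Hz.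
  assert (H1 := Rmin_l (u - uN) (uS - u)); assert (H2 := Rmin_r (u - uN) (uS - u)).
  apply Rabs_def2 in Hz.
  apply (RInt_correct G uN z), turn_density_ex_RInt; lra. }
set (F := fun s => weight g h y (osc a b s) * half_turn h c (osc a b s) + I (osc a b s) - v s).
assert (HF : F PI - F 0 = 0).
{ destruct (MVT_gen F 0 PI (fun _ => 0)) as [z [_ Hz]].
  - rewrite Rmin_left, Rmax_right by lra; intros s Hs.
    assert (Hsin : 0 < sin s) by (apply sin_gt_0; lra).
    assert (Hos : a < osc a b s < b).
    { assert (H := osc_prod a b s); assert (H1 := Ho s).
      assert (0 < (b - a) / 2 * sin s) by nra.
      assert (0 < (osc a b s - a) * (b - osc a b s)) by (rewrite H; nra).
      split; nra. }
    assert (Hu : uN <= osc a b s <= uS) by lra.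
    assert (H0 := Hm _ Hos).
    destruct (HQ _ (Ho s)) as (_ & HQp & HQe); rewrite osc_prod in HQe.
    assert (Hroot : sqrt (h (osc a b s) ^ 2 - c ^ 2) = (b - a) / 2 * sin s * sqrt (Q (osc a b s))).
    { rewrite HQe, sqrt_mult_alt by apply pow2_ge_0; rewrite sqrt_pow2 by nra; reflexivity. }
    evar_last.
    + apply (is_derive_minus (fun s => weight g h y (osc a b s) * half_turn h c (osc a b s)
               + I (osc a b s)) v); [|apply (is_derive_primitive f), Hf].
      apply (is_derive_plus (fun s => weight g h y (osc a b s) * half_turn h c (osc a b s))
               (fun s => I (osc a b s))).
      * apply (is_derive_compR (fun u => weight g h y u * half_turn h c u) (osc a b));
          [|apply is_derive_osc].
        apply (is_derive_mulR (weight g h y) (half_turn h c));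
          [apply is_derive_weight, Hu | apply is_derive_half_turn; lra].
      * apply (is_derive_compR I (osc a b)); [apply HI, Ho | apply is_derive_osc].
    (* The [dweight] terms cancel, and weight * h' + rest recombines to sqrt E. *)
    + unfold G, turn_density, f, turn_rate.
      rewrite (rest_Rmax (osc a b s) (fun m => c / (m * sqrt (m ^ 2 - c ^ 2)))).
      rewrite <- weight_rest by exact Hu; rewrite Hroot.
      assert (HQr := sqrt_lt_R0 _ HQp).
      unfold minus, plus, opp; simpl.
      set (u := osc a b s) in *; field; repeat split; lra.
  - rewrite Rmin_left, Rmax_right by lra; intros s Hs.
    apply continuity_pt_filterlim; change (continuous F s); unfold F; cont_step; [cont_step|].
    + apply (continuous_osc (fun u => weight g h y u * half_turn h c u)); [lra|]; intros u Hu.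
      cont_step; [apply (ex_derive_continuous (weight g h y)); eexists; apply is_derive_weight; lra|].
      apply continuous_eps; intros eps Heps.
      destruct (half_turn_cont2 c u (proj1 Hc) ltac:(lra) (mkposreal eps Heps)) as [d Hd].
      exists d; split; [apply cond_pos|]; intros w Hw; apply Hd; [|exact Hw].
      replace (c - c) with 0 by ring; rewrite Rabs_R0; apply cond_pos.
    + apply (continuous_osc I); [lra|]; intros u Hu.
      apply (ex_derive_continuous I); eexists; apply HI, Hu.
    + apply (ex_derive_continuous v); eexists; apply (is_derive_primitive f), Hf.
  - lra. }
assert (HoP : osc a b PI = b) by (unfold osc; rewrite cos_PI; field).
assert (Ho0 : osc a b 0 = a) by (unfold osc; rewrite cos_0; field).
unfold F in HF; rewrite HoP, Ho0, !half_turn_low in HF by lra.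
assert (Hv0 : v 0 = 0) by apply (RInt_point 0 f).
(* As c < y, both [rest] and [half_turn] vanish where h <= c, so the density contributes nothing
   outside [a, b]. *)
assert (HGl : forall u, h u <= c -> - c <= h u -> G u = 0).
{ intros u Hu1 Hu2; unfold G, turn_density, rest.
  rewrite half_turn_low, bump_low by lra; unfold Rdiv; ring. }
assert (HIa : I a = 0).
{ apply RInt_zero; [lra|]; intros u Hu; apply HGl; apply Hl, Hu. }
assert (HIS : RInt G b uS = 0).
{ apply RInt_zero; [lra|]; intros u Hu; apply HGl; apply Hr, Hu. }
assert (HCh : RInt G uN uS = I b + RInt G b uS).
{ symmetry; apply (RInt_Chasles G); apply turn_density_ex_RInt; lra. }
change (v PI = RInt G uN uS); rewrite HCh, HIS; lra.
Qed.

(** * The limit of the turning angle as the Clairaut constant tends to 0 *)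

Lemma half_turn_bounds c u : 0 < c -> 0 <= half_turn h c u <= PI / 2.
Proof.
intros Hc; unfold half_turn; set (w := sqrt (h u ^ 2 - c ^ 2) / c).
assert (Hw : 0 <= w) by (apply Rdiv_le_0_compat; [apply sqrt_pos | exact Hc]).
assert (H := atan_bound w); split; [|lra].
rewrite <- atan_0; destruct Hw as [Hw | <-]; [apply Rlt_le, atan_increasing, Hw | lra].
Qed.

Lemma half_turn_limit e eta : 0 < e < PI / 2 -> 0 < eta ->
  exists d, 0 < d /\ forall c u, 0 < c < d -> eta <= h u -> PI / 2 - e <= half_turn h c u.
Proof.
intros He Heta; set (X := tan (PI / 2 - e)).
assert (HX : 0 < X) by (apply tan_gt_0; lra).
(* From c (1 + X) < h u and (1 + X)^2 >= 1 + X^2 follows h^2 - c^2 >= (X c)^2, hence an atan of at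
   least PI / 2 - e. *)
exists (eta / (1 + X)); split; [apply Rdiv_lt_0_compat; lra|]; intros c u Hc Hu.
assert (H1 : c * (1 + X) < eta).
{ replace eta with (eta / (1 + X) * (1 + X)) by (field; lra); apply Rmult_lt_compat_r; lra. }
assert (H2 : X * c <= sqrt (h u ^ 2 - c ^ 2)).
{ rewrite <- (sqrt_pow2 (X * c)) by nra; apply sqrt_le_1_alt.
  assert ((c * (1 + X)) ^ 2 <= h u ^ 2) by (apply pow_incr; nra).
  assert (0 <= c ^ 2 * X) by (apply Rmult_le_pos; [apply pow2_ge_0 | lra]); nra. }
rewrite <- (atan_tan (PI / 2 - e)) by lra; unfold half_turn; fold X.
assert (H3 : X <= sqrt (h u ^ 2 - c ^ 2) / c).
{ apply Rmult_le_reg_r with c; [lra|]; replace (sqrt (h u ^ 2 - c ^ 2) / c * c)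
    with (sqrt (h u ^ 2 - c ^ 2)) by (field; lra); exact H2. }
destruct H3 as [H3 | <-]; [apply Rlt_le, atan_increasing, H3 | lra].
Qed.

Lemma bounded_on (f : R -> R) : (forall u, uN <= u <= uS -> continuous f u) ->
  exists M, 0 < M /\ forall u, uN <= u <= uS -> Rabs (f u) <= M.
Proof.
intros Hf; destruct (continuity_ab_maj (fun u => Rabs (f u)) uN uS) as [M [HM _]].
- lra.
- intros u Hu; apply continuity_pt_filterlim, (continuous_comp f Rabs);
    [apply Hf, Hu | apply continuous_Rabs].
- exists (Rabs (f M) + 1); split; [assert (H := Rabs_pos (f M)); lra|].
  intros u Hu; specialize (HM u Hu); lra.
Qed.

(** Its integral is D(c) minus the claimed limit. The added term turns - dweight * half_turn into
    dweight * (PI / 2 - half_turn), which is small away from the poles. *)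
Definition turn_excess (c u : R) : R := turn_density g h y c u + PI / 2 * dweight g h y u.

Lemma turn_excess_ex_RInt c u v : 0 < c < y -> uN <= u <= uS -> uN <= v <= uS ->
  ex_RInt (turn_excess c) u v.
Proof.
intros Hc Hu Hv; apply (ex_RInt_continuous (turn_excess c)); intros z Hz.
assert (Hz' : uN <= z <= uS) by (revert Hz; unfold Rmin, Rmax; destruct (Rle_dec u v); lra).
unfold turn_excess; repeat cont_step;
  [apply turn_density_continuous; assumption | apply dweight_continuous, Hz'].
Qed.

Lemma RInt_turn_excess c : 0 < c < y ->
  RInt (turn_excess c) uN uS =
  RInt (turn_density g h y c) uN uS - (weight g h y uN - weight g h y uS) * (PI / 2).
Proof.
intros Hc.
assert (Hw : is_RInt (dweight g h y) uN uS (weight g h y uS - weight g h y uN)).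
{ apply (is_RInt_derive (weight g h y) (dweight g h y)).
  - intros u; rewrite Rmin_left, Rmax_right by lra; apply is_derive_weight.
  - intros u; rewrite Rmin_left, Rmax_right by lra; apply dweight_continuous. }
apply is_RInt_unique; evar_last.
- apply (is_RInt_plus (turn_density g h y c) (fun u => PI / 2 * dweight g h y u)).
  + apply (RInt_correct (turn_density g h y c)), turn_density_ex_RInt; lra.
  + apply (is_RInt_scal (dweight g h y) uN uS (PI / 2)), Hw.
- unfold plus, scal; simpl; unfold mult; simpl; ring.
Qed.

(** The [rest] term is of order c: for c < y / 2 the root is at least y / 2, so the denominator is
    at least y^2 / 2. The other term is controlled by the distance [k] of [half_turn] from PI /
    2. *)
Lemma turn_excess_bound (M1 M2 c u k : R) : 0 < c < y / 2 -> uN <= u <= uS ->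
  0 < M1 -> Rabs (rest g h y u) <= M1 -> Rabs (dweight g h y u) <= M2 ->
  PI / 2 - half_turn h c u <= k ->
  Rabs (turn_excess c u) <= M1 * (2 / y ^ 2) * c + M2 * k.
Proof.
intros Hc Hu HM1 H1 H2 H3; unfold turn_excess, turn_density.
set (m := Rmax y (h u)); assert (Hm : y <= m) by apply Rmax_l.
assert (Hroot : y / 2 <= sqrt (m ^ 2 - c ^ 2)).
{ rewrite <- (sqrt_pow2 (y / 2)) by lra; apply sqrt_le_1_alt; nra. }
assert (Hfrac : 0 <= c / (m * sqrt (m ^ 2 - c ^ 2)) <= 2 / y ^ 2 * c).
{ split; [apply Rdiv_le_0_compat; nra|].
  replace (2 / y ^ 2 * c) with (c * / (y * (y / 2))) by (field; lra).
  apply Rmult_le_compat_l; [lra|]; apply Rinv_le_contravar; [nra|].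
  apply Rmult_le_compat; lra. }
assert (Hh0 := half_turn_bounds c u ltac:(lra)).
replace (rest g h y u * (c / (m * sqrt (m ^ 2 - c ^ 2))) - dweight g h y u * half_turn h c u
   + PI / 2 * dweight g h y u)
  with (rest g h y u * (c / (m * sqrt (m ^ 2 - c ^ 2)))
        + dweight g h y u * (PI / 2 - half_turn h c u)) by ring.
eapply Rle_trans; [apply Rabs_triang|]; rewrite !Rabs_mult.
rewrite (Rabs_pos_eq (c / (m * sqrt (m ^ 2 - c ^ 2)))) by apply Hfrac.
rewrite (Rabs_pos_eq (PI / 2 - half_turn h c u)) by lra.
apply Rplus_le_compat.
- rewrite Rmult_assoc; apply Rmult_le_compat; try apply Rabs_pos; lra.
- apply Rmult_le_compat; try apply Rabs_pos; lra.
Qed.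

(** [half_turn] does not tend to PI / 2 uniformly near the ends, where h may approach 0. End pieces
    of length [dl] are cut off, on which a bounded integrand suffices; on the middle piece h has a
    positive minimum and the convergence is uniform. *)
Lemma turn_limit : (forall u, uN < u < uS -> 0 < h u) -> forall eps, 0 < eps ->
  exists d, 0 < d /\ forall c, 0 < c < d -> c < y ->
  Rabs (RInt (turn_density g h y c) uN uS
        - (weight g h y uN - weight g h y uS) * (PI / 2)) < eps.
Proof.
intros Hpos eps Heps.
destruct (bounded_on _ rest_continuous) as [M1 [HM1 H1]].
destruct (bounded_on _ dweight_continuous) as [M2 [HM2 H2]].
assert (Hpi := PI2_3_2); assert (Hpi4 := PI_4).
set (L := uS - uN); assert (HL : 0 < L) by (unfold L; lra).
assert (Hd1 : 0 < eps / (16 * M2)) by (apply Rdiv_lt_0_compat; lra).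
set (dl := Rmin (L / 4) (eps / (16 * M2))).
assert (Hdl : 0 < dl) by (apply Rmin_pos; lra).
assert (HdlL : dl <= L / 4) by apply Rmin_l.
assert (HdlM : dl * M2 <= eps / 16).
{ replace (eps / 16) with (eps / (16 * M2) * M2) by (field; lra).
  apply Rmult_le_compat_r; [lra | apply Rmin_r]. }
(* The bound 1 keeps [e] below PI / 2, as [half_turn_limit] requires. *)
set (e := Rmin 1 (eps / (4 * L * M2))).
assert (He : 0 < e).
{ apply Rmin_pos; [lra | apply Rdiv_lt_0_compat; [lra | apply Rmult_lt_0_compat; lra]]. }
assert (He1 : e <= 1) by apply Rmin_l.
assert (HeM : L * (M2 * e) <= eps / 4).
{ replace (eps / 4) with (L * (M2 * (eps / (4 * L * M2)))) by (field; lra).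
  apply Rmult_le_compat_l; [lra|]; apply Rmult_le_compat_l; [lra | apply Rmin_r]. }
destruct (continuity_ab_min h (uN + dl) (uS - dl)) as [um [Hum Hum']].
{ unfold L in *; lra. }
{ intros u Hu; apply continuity_pt_filterlim, h_continuous; lra. }
destruct (half_turn_limit e (h um)) as [d3 [Hd3 H3]].
{ lra. }
{ apply Hpos; lra. }
set (K := M1 * (2 / y ^ 2)).
assert (HK : 0 < K).
{ apply Rmult_lt_0_compat; [lra | apply Rdiv_lt_0_compat; [lra | apply pow_lt, Hy]]. }
assert (Hd4 : 0 < eps / (8 * L * K)).
{ apply Rdiv_lt_0_compat; [lra | apply Rmult_lt_0_compat; lra]. }
exists (Rmin (y / 2) (Rmin d3 (eps / (8 * L * K)))); split.
{ repeat apply Rmin_pos; lra. }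
intros c Hc Hcy.
assert (Hc1 : c < y / 2) by (eapply Rlt_le_trans; [apply Hc | apply Rmin_l]).
assert (Hc' : c < Rmin d3 (eps / (8 * L * K))) by (eapply Rlt_le_trans; [apply Hc | apply Rmin_r]).
assert (Hc3 : c < d3) by (eapply Rlt_le_trans; [apply Hc' | apply Rmin_l]).
assert (Hc4 : c < eps / (8 * L * K)) by (eapply Rlt_le_trans; [apply Hc' | apply Rmin_r]).
assert (HKc : L * (K * c) <= eps / 8).
{ replace (eps / 8) with (L * (K * (eps / (8 * L * K)))) by (field; lra).
  apply Rmult_le_compat_l; [lra|]; apply Rmult_le_compat_l; lra. }
rewrite <- RInt_turn_excess by lra.
set (B := turn_excess c).
assert (Hex : forall u v, uN <= u <= uS -> uN <= v <= uS -> ex_RInt B u v).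
{ intros; apply turn_excess_ex_RInt; [lra | assumption..]. }
assert (HdL2 : 2 * dl <= L) by lra; unfold L in HdL2.
assert (Hsum : RInt B uN uS = RInt B uN (uN + dl) + (RInt B (uN + dl) (uS - dl) + RInt B (uS - dl) uS)).
{ transitivity (RInt B uN (uN + dl) + RInt B (uN + dl) uS).
  - symmetry; apply (RInt_Chasles B); apply Hex; lra.
  - f_equal; symmetry; apply (RInt_Chasles B); apply Hex; lra. }
(* The 2 is a bound for PI / 2 - half_turn, as PI <= 4. *)
assert (Hend : forall u, uN <= u <= uS -> Rabs (B u) <= K * c + M2 * 2).
{ intros u Hu; apply turn_excess_bound; auto; [lra|].
  assert (H := half_turn_bounds c u ltac:(lra)); lra. }
assert (Hmid : forall u, uN + dl <= u <= uS - dl -> Rabs (B u) <= K * c + M2 * e).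
{ intros u Hu; apply turn_excess_bound; [lra | lra | lra | apply H1; lra | apply H2; lra|].
  assert (H := H3 c u ltac:(lra) (Hum u Hu)); lra. }
assert (I1 : Rabs (RInt B uN (uN + dl)) <= (uN + dl - uN) * (K * c + M2 * 2)).
{ apply abs_RInt_le_const; [lra | apply Hex; lra | intros; apply Hend; lra]. }
assert (I3 : Rabs (RInt B (uS - dl) uS) <= (uS - (uS - dl)) * (K * c + M2 * 2)).
{ apply abs_RInt_le_const; [lra | apply Hex; lra | intros; apply Hend; lra]. }
assert (I2 : Rabs (RInt B (uN + dl) (uS - dl)) <= (uS - dl - (uN + dl)) * (K * c + M2 * e)).
{ apply abs_RInt_le_const; [lra | apply Hex; lra | exact Hmid]. }
replace (uN + dl - uN) with dl in I1 by ring.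
replace (uS - (uS - dl)) with dl in I3 by ring.
assert (HKp : 0 <= K * c) by nra.
assert (HMe : 0 <= M2 * e) by nra.
assert (I2' : (uS - dl - (uN + dl)) * (K * c + M2 * e) <= L * (K * c) + L * (M2 * e)).
{ unfold L; nra. }
assert (Hdk : dl * (K * c) <= L * (K * c)) by (apply Rmult_le_compat_r; lra).
(* Each end piece contributes at most eps / 32 + eps / 8 and the middle at most eps / 8 + eps / 4,
   in all 11 / 16 of eps. *)
rewrite Hsum; eapply Rle_lt_trans; [apply Rabs_triang|].
assert (I4 := Rabs_triang (RInt B (uN + dl) (uS - dl)) (RInt B (uS - dl) uS)).
rewrite Rmult_plus_distr_l in I1, I3.
replace (dl * (M2 * 2)) with (2 * (dl * M2)) in I1, I3 by ring.
assert (Hdk4 : dl * (K * c) <= eps / 32) by (assert (dl * (K * c) <= L / 4 * (K * c)) by (apply Rmult_le_compat_r; lra); lra).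
lra.
Qed.

End Turn.

(** * Closed geodesics *)

Lemma IVT_between (f : R -> R) (x y v : R) :
  x < y -> (forall z, x <= z <= y -> continuous f z) -> f x < v < f y \/ f y < v < f x ->
  exists z, x <= z <= y /\ f z = v.
Proof.
intros Hxy Hf [Hv|Hv].
- destruct (Ranalysis5.IVT_interv (fun z => f z - v) x y) as [z [Hz Hfz]]; try lra.
  + intros z Hz; apply continuity_pt_filterlim.
    apply (contR_minus f (fun _ => v)); [apply Hf, Hz | apply continuous_const].
  + exists z; split; [exact Hz | lra].
- destruct (Ranalysis5.IVT_interv (fun z => v - f z) x y) as [z [Hz Hfz]]; try lra.
  + intros z Hz; apply continuity_pt_filterlim.
    apply (contR_minus (fun _ => v) f); [apply continuous_const | apply Hf, Hz].
  + exists z; split; [exact Hz | lra].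
Qed.

Lemma strictly_increasing (f : R -> R) (a b : R) :
  (forall u, a <= u <= b -> ex_derive f u /\ 0 < Derive f u) ->
  forall x z, a <= x -> x < z -> z <= b -> f x < f z.
Proof.
intros H x z Hx Hxz Hz; destruct (MVT_gen f x z (Derive f)) as [w [Hw Heq]];
  rewrite ?Rmin_left, ?Rmax_right in * by lra.
- intros w Hw; apply Derive_correct, H; lra.
- intros w Hw; apply continuity_pt_filterlim, (ex_derive_continuous f), H; lra.
- assert (H1 := proj2 (H w ltac:(lra))); nra.
Qed.

Lemma strictly_decreasing (f : R -> R) (a b : R) :
  (forall u, a <= u <= b -> ex_derive f u /\ Derive f u < 0) ->
  forall x z, a <= x -> x < z -> z <= b -> f z < f x.
Proof.
intros H x z Hx Hxz Hz; apply Ropp_lt_cancel.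
apply (strictly_increasing (fun u => - f u) a b); try assumption.
intros u Hu; destruct (H u Hu) as [H1 H2]; split; [apply (ex_derive_opp f), H1|].
rewrite Derive_opp; lra.
Qed.

(** h is strictly monotone on a short interval at each pole and has a positive minimum on what
    remains. With [y] half of that minimum, a level below [y] is attained exactly once at each end
    and nowhere else. *)
Lemma levels_near_poles (h : R -> R) (uN uS : R) :
  uN < uS -> (forall u, uN <= u <= uS -> ex_derive h u /\ continuous (Derive h) u) ->
  0 < Derive h uN -> Derive h uS < 0 -> h uN = 0 -> h uS = 0 ->
  (forall u, uN < u < uS -> 0 < h u) ->
  exists y, 0 < y /\ (forall u, uN <= u <= uS -> h u <= y -> Derive h u <> 0) /\
    forall c, 0 < c < y -> exists a b, uN < a /\ a < b /\ b < uS /\ h a = c /\ h b = c /\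
      0 < Derive h a /\ Derive h b < 0 /\
      (forall u, uN <= u <= a -> h u <= c) /\ (forall u, b <= u <= uS -> h u <= c) /\
      (forall u, a < u < b -> c < h u).
Proof.
intros HNS Hh HN HS H0N H0S Hpos.
destruct (proj2 (continuous_eps _ uN) (proj2 (Hh uN ltac:(lra))) _ HN) as [d1 [Hd1 H1]].
destruct (proj2 (continuous_eps _ uS) (proj2 (Hh uS ltac:(lra))) (- Derive h uS) ltac:(lra))
  as [d2 [Hd2 H2]].
(* Halving makes [d] strictly smaller than [d1] and [d2] and keeps the two end intervals from
   overlapping. *)
set (d := Rmin (Rmin d1 d2) (uS - uN) / 2).
assert (Hd : 0 < d /\ d < d1 /\ d < d2 /\ 2 * d <= uS - uN).
{ unfold d; unfold Rmin; destruct (Rle_dec d1 d2);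
  repeat match goal with |- context [Rle_dec ?p ?q] => destruct (Rle_dec p q) end; lra. }
destruct Hd as (Hd & Hdd1 & Hdd2 & Hdd3).
set (u1 := uN + d); set (u2 := uS - d); assert (H12 : u1 <= u2) by (unfold u1, u2; lra).
assert (Hinc : forall u, uN <= u <= u1 -> ex_derive h u /\ 0 < Derive h u).
{ intros u Hu; split; [apply Hh; unfold u1, u2 in *; lra|].
  assert (H := H1 u); rewrite Rabs_pos_eq in H by lra; unfold u1 in Hu.
  assert (H' := Rabs_def2 _ _ (H ltac:(lra))); lra. }
assert (Hdec : forall u, u2 <= u <= uS -> ex_derive h u /\ Derive h u < 0).
{ intros u Hu; split; [apply Hh; unfold u1, u2 in *; lra|].
  assert (H := H2 u); rewrite Rabs_left1 in H by lra; unfold u2 in Hu.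
  assert (H' := Rabs_def2 _ _ (H ltac:(lra))); lra. }
assert (Hmi := strictly_increasing _ _ _ Hinc); assert (Hmd := strictly_decreasing _ _ _ Hdec).
assert (Hc : forall u, uN <= u <= uS -> continuous h u).
{ intros u Hu; apply (ex_derive_continuous h), Hh, Hu. }
destruct (continuity_ab_min h u1 u2 H12) as [um [Hum Hum']].
{ intros u Hu; apply continuity_pt_filterlim, Hc; unfold u1, u2 in *; lra. }
assert (Hhm : 0 < h um) by (apply Hpos; unfold u1, u2 in *; lra).
assert (Hmid : forall u, u1 <= u <= u2 -> h um / 2 < h u).
{ intros u Hu; specialize (Hum u Hu); lra. }
assert (HuN : uN < u1) by (unfold u1; lra); assert (HuS : u2 < uS) by (unfold u2; lra).
exists (h um / 2); split; [lra | split].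
- intros u Hu Hlow; destruct (Rle_dec u u1) as [l1|l1].
  + assert (H := proj2 (Hinc u ltac:(lra))); lra.
  + destruct (Rle_dec u2 u) as [l2|l2].
    * assert (H := proj2 (Hdec u ltac:(lra))); lra.
    * assert (H := Hmid u ltac:(lra)); lra.
- intros c Hcy.
  assert (Hv1 := Hmid u1 ltac:(lra)); assert (Hv2 := Hmid u2 ltac:(lra)).
  destruct (IVT_between h uN u1 c) as [a [Ha Hac]]; [lra | intros; apply Hc; lra | lra|].
  destruct (IVT_between h u2 uS c) as [b [Hb Hbc]]; [lra | intros; apply Hc; lra | lra|].
  assert (Ha1 : uN < a < u1).
  { split; [destruct (Req_dec a uN) as [e|]; [rewrite e in Hac|]; lra|].
    destruct (Req_dec a u1) as [e|]; [rewrite e in Hac|]; lra. }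
  assert (Hb1 : u2 < b < uS).
  { split; [destruct (Req_dec b u2) as [e|]; [rewrite e in Hbc|]; lra|].
    destruct (Req_dec b uS) as [e|]; [rewrite e in Hbc|]; lra. }
  exists a, b; split; [lra | split; [lra | split; [lra | split; [exact Hac | split; [exact Hbc|]]]]].
  split; [apply Hinc; lra | split; [apply Hdec; lra|]].
  split; [|split].
  + intros u Hu; destruct (Req_dec u a) as [->|n]; [lra|].
    assert (H := Hmi u a ltac:(lra) ltac:(lra) ltac:(lra)); lra.
  + intros u Hu; destruct (Req_dec u b) as [->|n]; [lra|].
    assert (H := Hmd b u ltac:(lra) ltac:(lra) ltac:(lra)); lra.
  + intros u Hu; destruct (Rle_dec u u1) as [l1|l1].
    * assert (H := Hmi a u ltac:(lra) ltac:(lra) ltac:(lra)); lra.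
    * destruct (Rle_dec u2 u) as [l2|l2].
      -- assert (H := Hmd u b ltac:(lra) ltac:(lra) ltac:(lra)); lra.
      -- assert (H := Hmid u ltac:(lra)); lra.
Qed.

(** One fraction p / n with x < p / n < z is found by rounding up n x, where n (z - x) > 1; [p] is
    natural because x >= 0. The fractions p / n + 1 / (n (M + i)) are then distinct, and a large [M]
    keeps them below [z]. *)
Lemma rationals_between (x z : R) : 0 <= x -> x < z ->
  exists P N : nat -> nat, (forall i, (0 < N i)%nat /\ x < INR (P i) / INR (N i) < z) /\
    forall i j, i <> j -> INR (P i) / INR (N i) <> INR (P j) / INR (N j).
Proof.
intros Hx Hxz.
assert (Hfrac : forall w, 0 < w -> exists n : nat, (0 < n)%nat /\ 1 < INR n * w).
{ intros w Hw; destruct (INR_archimed w 1 Hw) as [n Hn]; exists n; split; [|lra].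
  destruct n; [simpl in Hn; lra | lia]. }
destruct (Hfrac (z - x)) as [n [Hn0 Hn]]; [lra|].
assert (Hn1 : 0 < INR n) by (apply lt_0_INR, Hn0).
destruct (archimed (INR n * x)) as [Hup1 Hup2].
assert (Hnx : 0 <= INR n * x) by nra.
assert (Hz0 : (0 <= up (INR n * x))%Z) by (apply le_IZR; lra).
destruct (IZN _ Hz0) as [p Hp]; rewrite Hp, <- INR_IZR_INZ in Hup1, Hup2.
assert (Hpz : INR p < INR n * z) by lra.
destruct (Hfrac (INR n * z - INR p)) as [M [HM0 HM]]; [lra|].
assert (HM1 : 0 < INR M) by (apply lt_0_INR, HM0).
assert (Hval : forall i, INR (p * (M + i) + 1) / INR (n * (M + i))
  = INR p / INR n + / (INR n * (INR M + INR i))).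
{ intros i; assert (Hi := pos_INR i); rewrite plus_INR, !mult_INR, plus_INR; simpl; field; lra. }
exists (fun i => (p * (M + i) + 1)%nat), (fun i => (n * (M + i))%nat); split.
- intros i; assert (Hi := pos_INR i); split; [apply Nat.mul_pos_pos; lia|]; rewrite Hval.
  assert (Hq : 0 < INR n * (INR M + INR i)) by (apply Rmult_lt_0_compat; lra).
  assert (Hq1 := Rinv_0_lt_compat _ Hq); split.
  + apply Rlt_trans with (INR p / INR n); [|lra].
    apply Rmult_lt_reg_l with (INR n); [exact Hn1|].
    replace (INR n * (INR p / INR n)) with (INR p) by (field; lra); lra.
  + apply Rmult_lt_reg_l with (INR n * (INR M + INR i)); [exact Hq|].
    replace (INR n * (INR M + INR i) * (INR p / INR n + / (INR n * (INR M + INR i))))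
      with ((INR M + INR i) * INR p + 1) by (field; lra).
    nra.
- intros i j Hij; rewrite !Hval; intros E; apply Hij, INR_eq.
  assert (Hi := pos_INR i); assert (Hj := pos_INR j).
  apply Rplus_eq_reg_l, Rinv_eq_reg, Rmult_eq_reg_l in E; lra.
Qed.

(* Either D is constant, hence equal to its limit at 0, or it takes every value
   of some interval. *)
Lemma rational_values (D : R -> R) (y L : R) (n0 p0 : nat) :
  0 < y -> (forall c, 0 < c < y -> continuous D c) -> (forall c, 0 < c < y -> 0 <= D c) ->
  (forall eps, 0 < eps -> exists d, 0 < d /\
     forall c, 0 < c < d -> c < y -> Rabs (D c - L) < eps) ->
  (0 < n0)%nat -> INR n0 * L = INR p0 * PI ->
  exists C : nat -> R,
    (forall i, 0 < C i < y /\
       exists n p : nat, (0 < n)%nat /\ INR n * D (C i) = INR p * PI) /\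
    (forall i j, i <> j -> C i <> C j).
Proof.
intros Hy HD Hnn Hlim Hn0 HL; assert (Hpi := PI_RGT_0).
destruct (classic (exists c1 c2, 0 < c1 < y /\ 0 < c2 < y /\ D c1 < D c2)) as [H|H].
- destruct H as (c1 & c2 & Hc1 & Hc2 & Hlt).
  destruct (rationals_between (D c1 / PI) (D c2 / PI)) as (P & N & HPN & Hne).
  { apply Rdiv_le_0_compat; [apply Hnn, Hc1 | exact Hpi]. }
  { apply Rmult_lt_compat_r; [apply Rinv_0_lt_compat, Hpi | exact Hlt]. }
  assert (Hex : forall i, exists c, 0 < c < y /\ D c = INR (P i) / INR (N i) * PI).
  { intros i; destruct (HPN i) as [_ [H1 H2]]; set (r := INR (P i) / INR (N i)) in *.
    assert (H1' : D c1 < r * PI).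
    { replace (D c1) with (D c1 / PI * PI) by (field; lra); apply Rmult_lt_compat_r; assumption. }
    assert (H2' : r * PI < D c2).
    { replace (D c2) with (D c2 / PI * PI) by (field; lra); apply Rmult_lt_compat_r; assumption. }
    destruct (Rtotal_order c1 c2) as [l|[e|l]].
    - destruct (IVT_between D c1 c2 (r * PI)) as [c [Hc Hv]]; [exact l | | lra|].
      + intros; apply HD; lra.
      + exists c; split; [lra | exact Hv].
    - rewrite e in Hlt; lra.
    - destruct (IVT_between D c2 c1 (r * PI)) as [c [Hc Hv]]; [exact l | | lra|].
      + intros; apply HD; lra.
      + exists c; split; [lra | exact Hv]. }
  set (C := fun i => proj1_sig (constructive_indefinite_description _ (Hex i))).
  assert (HC : forall i, 0 < C i < y /\ D (C i) = INR (P i) / INR (N i) * PI)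
    by (intros i; exact (proj2_sig (constructive_indefinite_description _ (Hex i)))).
  exists C; split.
  + intros i; split; [apply HC|]; exists (N i), (P i); split; [apply HPN|].
    rewrite (proj2 (HC i)); field.
    assert (0 < INR (N i)) by (apply lt_0_INR, HPN); lra.
  + intros i j Hij E; apply (Hne i j Hij).
    apply Rmult_eq_reg_r with PI; [|lra].
    rewrite <- (proj2 (HC i)), <- (proj2 (HC j)), E; reflexivity.
- assert (Hconst : forall c, 0 < c < y -> D c = L).
  { intros c Hc; destruct (Req_dec (D c) L) as [e|n]; [exact e | exfalso].
    (* With |D c - L| itself as the tolerance, a point close enough to 0 has a value of [D]
       different from [D c], and these two points contradict the negated case. *)
    assert (He : 0 < Rabs (D c - L)) by (apply Rabs_pos_lt; lra).
    destruct (Hlim _ He) as [d [Hd H1]].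
    assert (Hm : 0 < Rmin d y / 2 < Rmin d y) by (assert (0 < Rmin d y) by (apply Rmin_pos; lra); lra).
    assert (Hm1 := Rmin_l d y); assert (Hm2 := Rmin_r d y).
    specialize (H1 (Rmin d y / 2) ltac:(lra) ltac:(lra)).
    replace (D (Rmin d y / 2)) with (D c) in H1; [lra|].
    destruct (Rtotal_order (D c) (D (Rmin d y / 2))) as [l|[e|l]]; [|exact e|];
      exfalso; apply H.
    - exists c, (Rmin d y / 2); repeat split; lra.
    - exists (Rmin d y / 2), c; repeat split; lra. }
  (* Any distinct constants below [y] serve; the 2 keeps the first of them away from [y] itself. *)
  exists (fun i => y / (INR i + 2)).
  assert (HC : forall i, 0 < y / (INR i + 2) < y).
  { intros i; assert (Hi := pos_INR i); split; [apply Rdiv_lt_0_compat; lra|].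
    apply Rmult_lt_reg_r with (INR i + 2); [lra|].
    replace (y / (INR i + 2) * (INR i + 2)) with y by (field; lra); nra. }
  split.
  + intros i; split; [apply HC|]; exists n0, p0; rewrite Hconst by apply HC; auto.
  + intros i j Hij E; apply Hij, INR_eq.
    assert (Hi := pos_INR i); assert (Hj := pos_INR j).
    unfold Rdiv in E; apply Rmult_eq_reg_l, Rinv_eq_reg in E; lra.
Qed.

Lemma smooth_on_C2 (a b : R) (f : R -> R) : smooth_on a b f -> forall u, a <= u <= b ->
  ex_derive f u /\ ex_derive (Derive f) u /\ continuous (Derive (Derive f)) u.
Proof.
intros [eps [Heps H]] u Hu; assert (Hu' : a - eps < u < b + eps) by lra.
split; [exact (H 1%nat u Hu') | split; [exact (H 2%nat u Hu')|]].
apply (ex_derive_continuous (Derive (Derive f))); exact (H 3%nat u Hu').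
Qed.

Theorem theorem1p1 (g h : R -> R) (uN uS : R)
    (hM : orbifold_of_revolution g h uN uS) :
  infinitely_many_closed_geodesics g h uN uS.
Proof.
destruct hM as [[HNS Hsg Hsh Hreg _ Hnn Hzero] (m & k & Hm & Hk & HphiN & HphiS)].
assert (Hsm : forall f, f = g \/ f = h -> forall u, uN <= u <= uS ->
  ex_derive f u /\ ex_derive (Derive f) u /\ continuous (Derive (Derive f)) u).
{ intros f [-> | ->]; apply smooth_on_C2; assumption. }
assert (HE : forall u, uN <= u <= uS -> 0 < speed2 g h u).
{ intros u Hu; unfold speed2; assert (H := Hreg u Hu).
  assert (H1 := pow2_ge_0 (Derive g u)); assert (H2 := pow2_ge_0 (Derive h u)).
  destruct (Req_dec (Derive g u) 0) as [e1|n1]; [|assert (H3 := pow2_gt_0 _ n1); lra].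
  destruct (Req_dec (Derive h u) 0) as [e2|n2]; [tauto | assert (H3 := pow2_gt_0 _ n2); lra]. }
assert (H0N : h uN = 0) by (apply Hzero; [lra | auto]).
assert (H0S : h uS = 0) by (apply Hzero; [lra | auto]).
assert (Hpos : forall u, uN < u < uS -> 0 < h u).
{ intros u Hu; destruct (Hnn u ltac:(lra)) as [l|e]; [exact l|].
  symmetry in e; apply Hzero in e; lra. }
assert (Hm0 : 0 < INR m) by (apply lt_0_INR, Hm); assert (Hk0 : 0 < INR k) by (apply lt_0_INR, Hk).
assert (HsN := sqrt_lt_R0 _ (HE uN ltac:(lra))); assert (HsS := sqrt_lt_R0 _ (HE uS ltac:(lra))).
assert (HdN : Derive h uN = sqrt (speed2 g h uN) / INR m).
{ unfold sin_phi_N in HphiN; fold (speed2 g h uN) in HphiN.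
  replace (Derive h uN) with (Derive h uN / sqrt (speed2 g h uN) * sqrt (speed2 g h uN)) by (field; lra).
  rewrite HphiN; field; lra. }
assert (HdS : Derive h uS = - (sqrt (speed2 g h uS) / INR k)).
{ unfold sin_phi_S in HphiS; fold (speed2 g h uS) in HphiS.
  replace (Derive h uS) with (- (- Derive h uS / sqrt (speed2 g h uS) * sqrt (speed2 g h uS))) by (field; lra).
  rewrite HphiS; field; lra. }
assert (HdN0 : 0 < Derive h uN) by (rewrite HdN; apply Rdiv_lt_0_compat; lra).
assert (HdS0 : Derive h uS < 0) by (rewrite HdS; assert (H := Rdiv_lt_0_compat _ _ HsS Hk0); lra).
destruct (levels_near_poles h uN uS) as (y & Hy & Hlow & Hlev); try assumption.
{ intros u Hu; split; [apply (Hsm h); auto|].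
  apply (ex_derive_continuous (Derive h)), (Hsm h); auto. }
set (D := (fun c => RInt (turn_density g h y c) uN uS) : R -> R).
assert (Hosc : forall c, 0 < c < y -> 0 <= D c /\ exists gam : R -> R3,
    geodesic g h uN uS gam /\
    (forall t, c ^ 2 <= py (gam t) ^ 2 + pz (gam t) ^ 2) /\
    (exists t, py (gam t) ^ 2 + pz (gam t) ^ 2 = c ^ 2) /\
    (forall n p : nat, (0 < n)%nat -> INR n * D c = INR p * PI -> closed_geodesic g h uN uS gam)).
{ intros c Hc.
  destruct (Hlev c Hc) as (a & b & HNa & Hab & HbS & Hha & Hhb & Hda & Hdb & Hl & Hr & Hmid).
  assert (Hdh : forall u, uN <= u <= uS ->
    is_derive (fun u => h u ^ 2 - c ^ 2) u (2 * h u * Derive h u)).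
  { intros u Hu; destruct (Hsm h (or_intror eq_refl) u Hu) as [H _]; auto_derive; [auto|].
    change (Derive (fun x => h x) u) with (Derive h u); ring. }
  destruct (two_root_factor (fun u => h u ^ 2 - c ^ 2) a b (2 * c * Derive h a) (2 * c * Derive h b))
    as [Q HQ]; [exact Hab | | | | nra | nra | | | |].
  { intros u Hu; apply (ex_derive_continuous (fun u => h u ^ 2 - c ^ 2)); eexists; apply Hdh; lra. }
  { replace (2 * c * Derive h a) with (2 * h a * Derive h a) by (rewrite Hha; ring).
    apply Hdh; lra. }
  { replace (2 * c * Derive h b) with (2 * h b * Derive h b) by (rewrite Hhb; ring).
    apply Hdh; lra. }
  { rewrite Hha; ring. }
  { rewrite Hhb; ring. }
  { intros u Hu; specialize (Hmid u Hu); nra. }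
  assert (Hge : forall u, a <= u <= b -> c <= h u).
  { intros u Hu; destruct (Req_dec u a) as [->|na]; [lra|].
    destruct (Req_dec u b) as [->|nb]; [lra|]; assert (H := Hmid u ltac:(lra)); lra. }
  assert (HDc : RInt (turn_rate g h Q a b c) 0 PI = D c).
  { apply turn_formula; try assumption.
    - intros u Hu; split; [|apply Hl, Hu]; assert (H := Hnn u ltac:(lra)); lra.
    - intros u Hu; split; [|apply Hr, Hu]; assert (H := Hnn u ltac:(lra)); lra. }
  assert (Hpi := PI_RGT_0); split.
  (* The sign of D allows the rational multiples of PI to be taken with natural numerators. *)
  - rewrite <- HDc; apply RInt_ge_0; [lra | |].
    + apply (ex_RInt_continuous (turn_rate g h Q a b c)); intros s _.
      apply turn_rate_continuous; [lra|]; intros u Hu.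
      split; [apply (speed2_continuous g h uN uS Hsm); lra|].
      split; [apply (h_continuous g h uN uS Hsm); lra|].
      split; [apply Hpos; lra | split; apply HQ, Hu].
    + intros s _; unfold turn_rate; assert (Ho := osc_bound a b s ltac:(lra)).
      assert (Hho := Hge _ Ho); assert (HsQ := sqrt_lt_R0 _ (proj1 (proj2 (HQ _ Ho)))).
      apply Rdiv_le_0_compat; [|apply Rmult_lt_0_compat; lra].
      apply Rmult_le_pos; [lra | apply sqrt_pos].
  - rewrite <- HDc; apply oscillating_geodesic; try assumption; try lra.
    + intros f Hf u Hu; apply Hsm; [exact Hf | lra].
    + intros u Hu; apply HE; lra. }
(* At the poles the bump vanishes, so [weight] is sqrt E / h', which the cone angles make m at [uN]
   and - k at [uS]. Twice the limit is therefore (m + k) PI. *)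
destruct (rational_values D y ((weight g h y uN - weight g h y uS) * (PI / 2)) 2 (m + k))
  as (C & HC & Hinj).
- exact Hy.
- intros c Hc; apply turn_continuous; assumption.
- intros c Hc; apply Hosc, Hc.
- apply turn_limit; assumption.
- lia.
- unfold weight, bump_den; rewrite !bump_low, HdN, HdS, plus_INR by lra; simpl; field; lra.
- assert (Hex : forall i, exists gam : R -> R3, closed_geodesic g h uN uS gam /\
    (forall t, C i ^ 2 <= py (gam t) ^ 2 + pz (gam t) ^ 2) /\
    (exists t, py (gam t) ^ 2 + pz (gam t) ^ 2 = C i ^ 2)).
  { intros i; destruct (HC i) as [Hi (n & p & Hn & Hnp)].
    destruct (Hosc _ Hi) as [_ (gam & Hg1 & Hg2 & Hg3 & Hg4)].
    exists gam; split; [apply (Hg4 n p Hn Hnp) | split; assumption]. }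
  set (gam := fun i => proj1_sig (constructive_indefinite_description _ (Hex i))).
  assert (Hgam : forall i, closed_geodesic g h uN uS (gam i) /\
    (forall t, C i ^ 2 <= py (gam i t) ^ 2 + pz (gam i t) ^ 2) /\
    (exists t, py (gam i t) ^ 2 + pz (gam i t) ^ 2 = C i ^ 2))
    by (intros i; exact (proj2_sig (constructive_indefinite_description _ (Hex i)))).
  assert (Hle : forall i j, same_image (gam i) (gam j) -> C i <= C j).
  { intros i j Hij; destruct (Hgam i) as (_ & H1 & _); destruct (Hgam j) as (_ & _ & [t Ht]).
    destruct (proj2 (Hij (gam j t)) (ex_intro _ t eq_refl)) as [s Hs].
    specialize (H1 s); rewrite Hs, Ht in H1.
    destruct (HC i) as [Hi _]; destruct (HC j) as [Hj _]; nra. }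
  exists gam; split; [intros i; apply Hgam|].
  intros i j Hij Hsame; apply (Hinj i j Hij), Rle_antisym; [apply Hle, Hsame|].
  apply Hle; intros p; split; apply Hsame.
Qed.
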